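(* Let $X_1,X_2,\dots$ be i.i.d. $\sim P_X$ on a finite alphabet $\mathcal{X}$, let $\hat{\mathcal{X}}_1,\hat{\mathcal{X}}_2,\hat{\mathcal{Z}}_1$ be finite alphabets, let $d_i:\mathcal{X}\times\hat{\mathcal{X}}_i\to[0,\infty)$, $i=1,2$, be distortion measures, and let $g:\hat{\mathcal{X}}_1\to\hat{\mathcal{Z}}_1$ be a deterministic function. A $(2^{nR_0},2^{nR_1},n)$ code for successive refinement with deterministic-function strictly-causal cribbing consists of: - encoder maps $T_0=f_0(X^n)\in\{1,\dots,2^{nR_0}\}$ (to both decoders) and $T_1=f_1(X^n)\in\{1,\dots,2^{nR_1}\}$ (to Decoder 1 only); - a Decoder 1 map $\hat X_1^n=g_1(T_0,T_1)$; - Decoder 2 maps $\hat X_{2,i}=g_{2,i}(T_0,\hat Z_1^{i-1})$, $i=1,\dots,n$, where $\hat Z_{1,j}=g(\hat X_{1,j})$. A pair $(R_0,R_1)$ is achievable for $(D_1,D_2)$ if for every $\epsilon>0$ there exist $n$ and such a code with $\mathbb{E}\big[\frac1n\sum_{j} d_i(X_j,\hat X_{i,j})\big]\le D_i+\epsilon$, $i=1,2$. Let $\mathcal{R}(D_1,D_2)$ be the closure of the set of achievable pairs. Then $\mathcal{R}(D_1,D_2)$ is the closure of the set of all $(R_0,R_1)$ such that $$R_0+R_1\ge I(X;\hat X_1,\hat X_2),\qquad R_0\ge \{I(X;\hat Z_1,\hat X_2)-H(\hat Z_1|\hat X_2)\}^+$$ for some joint distribution of $(X,\hat X_1,\hat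 X_2)$ with $X\sim P_X$, where $\hat Z_1=g(\hat X_1)$, satisfying $\mathbb{E}[d_i(X,\hat X_i)]\le D_i$ for $i=1,2$.
   Context: $\{a\}^+=\max(a,0)$.
   Formalization: The equality of the two closures is stated for nonnegative rates R_0, R_1 only; for R_1<0 the single-letter set contains pairs such as large R_0 with R_1=-1, while the message set {1,…,2^{nR_1}} is empty, so no code exists. *)

(* Defs.v *)
From HB Require Import structures.
From mathcomp Require Import all_boot all_order all_algebra.
From mathcomp Require Import all_classical all_reals all_analysis.
Set Implicit Arguments. Unset Strict Implicit. Unset Printing Implicit Defensive.
Import Order.TTheory GRing.Theory Num.Theory.
Import numFieldNormedType.Exports.
Local Open Scope ring_scope.
Local Open Scope classical_set_scope.

Section InfoDefs.
Variable R : realType.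

Definition is_pmf (T : finType) (p : T -> R) : Prop :=
  (forall t, 0 <= p t) /\ \sum_(t : T) p t = 1.

Definition pushforward (T U : finType) (p : T -> R) (f : T -> U) (u : U) : R :=
  \sum_(t : T | f t == u) p t.

Definition log2 (x : R) : R := ln x / ln 2.

Definition entropy (U : finType) (q : U -> R) : R :=
  - \sum_(u : U) (if q u == 0 then 0 else q u * log2 (q u)).

Definition ent (T U : finType) (p : T -> R) (f : T -> U) : R :=
  entropy (pushforward p f).

Definition cond_ent (T U V : finType) (p : T -> R) (f : T -> U) (h : T -> V) : R :=
  ent p (fun t => (f t, h t)) - ent p h.

Definition mutual_info (T U V : finType) (p : T -> R) (f : T -> U) (h : T -> V) : R :=
  ent p f + ent p h - ent p (fun t => (f t, h t)).

Definition expect (T : finType) (p : T -> R) (F : T -> R) : R :=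
  \sum_(t : T) p t * F t.

Definition iid (X : finType) (PX : X -> R) (n : nat) (x : {ffun 'I_n -> X}) : R :=
  \prod_(i < n) PX (x i).

Arguments iid : clear implicits.

Section Code.
Variables (X Xh1 Xh2 Zh1 : finType) (g : Xh1 -> Zh1).
Variables (n M0 M1 : nat).
Variables (f0 : {ffun 'I_n -> X} -> 'I_M0) (f1 : {ffun 'I_n -> X} -> 'I_M1)
          (g1 : 'I_M0 -> 'I_M1 -> 'I_n -> Xh1)
          (g2 : 'I_n -> 'I_M0 -> seq Zh1 -> Xh2).

Definition dec1_out (x : {ffun 'I_n -> X}) (j : 'I_n) : Xh1 := g1 (f0 x) (f1 x) j.

Definition crib_seq (x : {ffun 'I_n -> X}) : seq Zh1 :=
  [seq g (dec1_out x j) | j <- enum 'I_n].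

(* Decoder 2: X^_{2,i} = g_{2,i}(T0, Z^_1^{i-1}) (strictly causal: only the
   first i cribbed symbols, with 0-based index i) *)
Definition dec2_out (x : {ffun 'I_n -> X}) (i : 'I_n) : Xh2 :=
  g2 i (f0 x) (take i (crib_seq x)).
End Code.

Definition achievable (X Xh1 Xh2 Zh1 : finType) (PX : X -> R)
  (d1 : X -> Xh1 -> R) (d2 : X -> Xh2 -> R) (g : Xh1 -> Zh1)
  (D1 D2 : R) (r : R * R) : Prop :=
  forall eps : R, 0 < eps ->
  exists (n : nat) (M0 M1 : nat),
    [/\ (0 < n)%N,
        M0%:R <= 2 `^ (n%:R * r.1),
        M1%:R <= 2 `^ (n%:R * r.2) &
    exists (f0 : {ffun 'I_n -> X} -> 'I_M0) (f1 : {ffun 'I_n -> X} -> 'I_M1)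
           (g1 : 'I_M0 -> 'I_M1 -> 'I_n -> Xh1)
           (g2 : 'I_n -> 'I_M0 -> seq Zh1 -> Xh2),
      expect (iid _ PX n) (fun x => n%:R^-1 *
          \sum_(j < n) d1 (x j) (dec1_out f0 f1 g1 x j)) <= D1 + eps /\
      expect (iid _ PX n) (fun x => n%:R^-1 *
          \sum_(j < n) d2 (x j) (dec2_out g f0 f1 g1 g2 x j)) <= D2 + eps].

Definition sr_region (X Xh1 Xh2 Zh1 : finType) (PX : X -> R)
  (d1 : X -> Xh1 -> R) (d2 : X -> Xh2 -> R) (g : Xh1 -> Zh1)
  (D1 D2 : R) (r : R * R) : Prop :=
  exists Q : {ffun X * Xh1 * Xh2 -> R},
    is_pmf Q /\
    (forall x : X, pushforward Q (fun t => t.1.1) x = PX x) /\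
    expect Q (fun t => d1 t.1.1 t.1.2) <= D1 /\
    expect Q (fun t => d2 t.1.1 t.2) <= D2 /\
    mutual_info Q (fun t => t.1.1) (fun t => (t.1.2, t.2)) <= r.1 + r.2 /\
    Num.max
      (mutual_info Q (fun t => t.1.1) (fun t => (g t.1.2, t.2))
       - cond_ent Q (fun t => g t.1.2) (fun t => t.2)) 0 <= r.1.

End InfoDefs.

(* Main.v *)
(* Write theta = I(X;Z1,X2) - H(Z1|X2); it equals H(X) - H(X,Z1|X2).

   Converse.  Let W be the conditional law of (X,Z1) given X2 under the
   time-averaged joint law of a code.  Since X2 at time i depends only on T0 and
   on the previous values of Z1, the products of W along all (T0, x^n, z^n) sum
   to at most 2^{n R0}, and Gibbs' inequality gives
   n H(X) <= n R0 + n H(X,Z1|X2).  The bound on R0 + R1 is the same with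
   (T0, T1), X and (X1,X2) in place of T0, (X,Z1) and X2.  A cluster point of
   these laws in the simplex removes the slack in the distortions.

   Achievability.  A single-block random code suffices.  For every T0 draw a tree
   whose nodes are the prefixes of z^n, with an i.i.d. letter X2 at each node;
   every T1 draws X1 ~ P(X1|X2) at each node and so selects a path.  The encoder
   looks for a path typical with x^n.  Let N be the mean over the code of the
   likelihood ratios of the typical paths.  Failure forces N = 0, so its
   probability is at most E (N - 1)^2.  Two paths in the same tree that share
   the first k values of z contribute about 2^{k theta - n R0}, which is small
   for all k <= n because R0 exceeds both theta and 0; a path paired with itself
   contributes 2^{n (I(X;X1,X2) - R0 - R1)}. *)

Require Import Defs.
From HB Require Import structures.
From mathcomp Require Import all_boot all_order all_algebra.
From mathcomp Require Import all_classical all_reals all_analysis.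
From mathcomp Require Import ring lra.
Set Implicit Arguments. Unset Strict Implicit. Unset Printing Implicit Defensive.
Import Order.TTheory GRing.Theory Num.Theory.
Import numFieldNormedType.Exports.
Local Open Scope ring_scope.
Local Open Scope classical_set_scope.

(** * Sums against product weights on finite functions *)

Section ProductSums.
Variables (R : realType).
Implicit Types (I T : finType).

Lemma sum_ffun_prod1 I T (w : I -> T -> R) (i0 : I) (phi : T -> R) :
  (forall i, \sum_t w i t = 1) ->
  \sum_(c : {ffun I -> T}) (\prod_i w i (c i)) * phi (c i0) =
  \sum_t w i0 t * phi t.
Proof.
move=> w1.
pose h i t := if i == i0 then phi t else 1.
rewrite (eq_bigr (fun c : {ffun I -> T} => \prod_i (w i (c i) * h i (c i)))).
  rewrite -(bigA_distr_bigA (fun i t => w i t * h i t)) (bigD1 i0) //=.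
  rewrite {1}/h eqxx [X in _ * X]big1 ?mulr1 // => i ni0.
  by rewrite -[RHS](w1 i); apply: eq_bigr => t _; rewrite /h (negbTE ni0) mulr1.
move=> c _; rewrite big_split /=; congr (_ * _).
by rewrite (bigD1 i0) //= {1}/h eqxx big1 ?mulr1 // => i /negbTE; rewrite /h => ->.
Qed.

Lemma sum_ffun_prod2 I T (w : I -> T -> R) (i0 i1 : I) (phi : T -> T -> R) :
  (forall i, \sum_t w i t = 1) -> i0 != i1 ->
  \sum_(c : {ffun I -> T}) (\prod_i w i (c i)) * phi (c i0) (c i1) =
  \sum_t \sum_u w i0 t * w i1 u * phi t u.
Proof.
move=> w1 i01; have i10 : i1 != i0 by rewrite eq_sym.
(* Expanding [phi] over the indicators of pairs (t, u) turns each term into a product of functions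
   of single coordinates. *)
rewrite (eq_bigr (fun c : {ffun I -> T} => \sum_t \sum_u phi t u *
    ((\prod_i w i (c i)) * ((c i0 == t)%:R * (c i1 == u)%:R)))); last first.
  move=> c _; rewrite (bigD1 (c i0)) //= (bigD1 (c i1)) //= !eqxx !mulr1.
  rewrite [X in _ + X + _]big1 ?addr0; last by move=> u /negbTE nu; rewrite eq_sym nu !mulr0.
  rewrite [X in _ + X]big1 ?addr0 1?mulrC// => t /negbTE nt; rewrite big1 // => u _.
  by rewrite eq_sym nt !(mul0r, mulr0).
rewrite exchange_big; apply: eq_bigr => t _ /=.
rewrite exchange_big; apply: eq_bigr => u _ /=.
rewrite -big_distrr /= mulrC; congr (_ * _).
pose h i v : R := if i == i0 then (v == t)%:R else if i == i1 then (v == u)%:R else 1.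
rewrite (eq_bigr (fun c : {ffun I -> T} => \prod_i (w i (c i) * h i (c i)))).
  rewrite -(bigA_distr_bigA (fun i t => w i t * h i t)) (bigD1 i0) //=.
  rewrite (bigD1 i1) //= /h !eqxx (negbTE i10) [X in _ * (_ * X)]big1 ?mulr1; last first.
    move=> i /andP[/negbTE-> /negbTE->]; rewrite -[RHS](w1 i).
    by apply: eq_bigr => v _; rewrite mulr1.
  by congr (_ * _);
    [rewrite (bigD1 t) //=|rewrite (bigD1 u) //=]; rewrite eqxx mulr1 big1 ?addr0 // =>
    v /negbTE->; rewrite mulr0.
move=> c _; rewrite big_split /=; congr (_ * _).
rewrite (bigD1 i0) //= (bigD1 i1) //= /h !eqxx (negbTE i10) [X in _ * (_ * X)]big1 ?mulr1 //.
by move=> i /andP[/negbTE-> /negbTE->].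
Qed.

End ProductSums.

(** * Sums over words with product weights *)

Section SequenceSums.
Variables (R : realType) (A : finType).
Implicit Types (w : A -> R) (phi psi : seq A -> R).

(** A recursion on the first letter, so that inductions can follow the levels of a codebook tree. *)
Fixpoint seqsum w n phi : R :=
  if n is n'.+1 then \sum_a w a * seqsum w n' (fun s => phi (a :: s))
  else phi [::].

Definition ffun_seq n (x : {ffun 'I_n -> A}) : seq A := [seq x i | i <- enum 'I_n].

Lemma size_ffun_seq n (x : {ffun 'I_n -> A}) : size (ffun_seq x) = n.
Proof. by rewrite size_map size_enum_ord. Qed.

Lemma nth_ffun_seq a n (x : {ffun 'I_n -> A}) (i : 'I_n) : nth a (ffun_seq x) i = x i.
Proof. by rewrite (nth_map i) ?size_enum_ord // nth_ord_enum. Qed.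

Lemma sum_ffunE w n phi :
  \sum_(x : {ffun 'I_n -> A}) (\prod_i w (x i)) * phi (ffun_seq x) = seqsum w n phi.
Proof.
elim: n phi => [|n IH] phi /=.
  rewrite (eq_bigr (fun=> phi [::])).
    by rewrite big_const card_ffun card_ord expn0 /= addr0.
  by move=> x _; rewrite big_ord0 mul1r /ffun_seq (size0nil (size_enum_ord 0)).
pose h (p : A * {ffun 'I_n -> A}) : {ffun 'I_n.+1 -> A} :=
  [ffun i => if unlift ord0 i is Some j then p.2 j else p.1].
pose h' (x : {ffun 'I_n.+1 -> A}) : A * {ffun 'I_n -> A} :=
  (x ord0, [ffun j => x (lift ord0 j)]).
have hK : cancel h h'.
  case=> a f; rewrite /h /h' /= ffunE unlift_none; congr pair.
  by apply/ffunP => j; rewrite !ffunE liftK.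
have h'K : cancel h' h.
  move=> x; apply/ffunP => i; rewrite ffunE.
  by case: unliftP => [j|] -> //=; rewrite ffunE.
rewrite (reindex h) /=; last by exists h' => ? _; rewrite ?hK ?h'K.
rewrite -(pair_big xpredT xpredT (fun a f => \prod_(i < n.+1) w (h (a, f) i) *
  phi (ffun_seq (h (a, f))))) /=.
apply: eq_bigr => a _; rewrite -IH big_distrr /=; apply: eq_bigr => f _.
rewrite big_ord_recl {1}/h ffunE unlift_none -mulrA; congr (_ * (_ * phi _)).
  by apply: eq_bigr => i _; rewrite ffunE liftK.
rewrite /ffun_seq enum_ordSl /= ffunE unlift_none; congr cons.
by rewrite -map_comp; apply: eq_map => i /=; rewrite ffunE liftK.
Qed.

Lemma eq_seqsum w n phi psi :
  (forall s, size s = n -> phi s = psi s) -> seqsum w n phi = seqsum w n psi.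
Proof.
elim: n phi psi => [|n IH] phi psi e /=; first exact: e.
by apply: eq_bigr => a _; rewrite (IH _ (fun s => psi (a :: s))) // => s ss; rewrite e //= ss.
Qed.

Lemma le_seqsum w n phi psi : (forall a, 0 <= w a) ->
  (forall s, size s = n -> phi s <= psi s) -> seqsum w n phi <= seqsum w n psi.
Proof.
move=> w0; elim: n phi psi => [|n IH] phi psi e /=; first exact: e.
by apply: ler_sum => a _; rewrite ler_wpM2l // IH // => s ss; rewrite e //= ss.
Qed.

Lemma seqsumD w n phi psi :
  seqsum w n (fun s => phi s + psi s) = seqsum w n phi + seqsum w n psi.
Proof.
elim: n phi psi => [//|n IH] phi psi /=; rewrite -big_split /=.
by apply: eq_bigr => a _; rewrite IH mulrDr.
Qed.

Lemma seqsumZ w n c phi : seqsum w n (fun s => c * phi s) = c * seqsum w n phi.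
Proof.
elim: n phi => [//|n IH] phi /=; rewrite big_distrr /=.
by apply: eq_bigr => a _; rewrite IH mulrCA.
Qed.

Lemma seqsum_sum w n (I : finType) (F : I -> seq A -> R) :
  seqsum w n (fun s => \sum_i F i s) = \sum_i seqsum w n (F i).
Proof.
elim: (index_enum I) => [|i r IH].
  rewrite big_nil -[RHS](mul0r (seqsum w n (fun=> 0))) -seqsumZ.
  by apply: eq_seqsum => s _; rewrite big_nil mulr0.
by rewrite big_cons -IH -seqsumD; apply: eq_seqsum => s _; rewrite big_cons.
Qed.

Lemma seqsum1 w n : \sum_a w a = 1 -> seqsum w n (fun=> 1) = 1.
Proof.
move=> w1; elim: n => [//|n IH] /=.
by rewrite -[RHS]w1; apply: eq_bigr => a _; rewrite IH mulr1.
Qed.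

Lemma seqsum_expR w n (f : A -> R) :
  seqsum w n (fun s => expR (\sum_(a <- s) f a)) = (\sum_a w a * expR (f a)) ^+ n.
Proof.
elim: n => [|n IH] /=; first by rewrite big_nil expR0.
rewrite exprS big_distrl /=; apply: eq_bigr => a _.
rewrite -mulrA -IH; congr (_ * _); rewrite -seqsumZ; apply: eq_seqsum => s _.
by rewrite big_cons expRD.
Qed.

End SequenceSums.

(** * Random tree codebooks *)

Lemma sum_triple (R : realType) (A B C : finType) (F : A * B * C -> R) :
  \sum_p F p = \sum_a \sum_b \sum_c F (a, b, c).
Proof. by rewrite !pair_bigA /=; apply: eq_bigr => -[[a b] c]. Qed.

Section TreeCode.
Variables (R : realType) (X Y1 Y2 Z : finType) (g : Y1 -> Z) (M1 : nat).
Variables (P : X -> R) (Q : X * Y1 * Y2 -> R).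
Hypothesis Q0 : forall a, 0 <= Q a.
Hypothesis Q1 : \sum_a Q a = 1.
Hypothesis QP : forall x, \sum_y1 \sum_y2 Q (x, y1, y2) = P x.

Local Notation A := (X * Y1 * Y2)%type.

Definition marg12 y1 y2 := \sum_x Q (x, y1, y2).
Definition marg2 y2 := \sum_y1 marg12 y1 y2.
Definition cond1 y2 y1 := marg12 y1 y2 / marg2 y2.
Definition cond12 x y1 y2 := Q (x, y1, y2) / P x.
(** The density of the joint law against the product of the laws of X and (X1, X2); its mean
    logarithm is I(X;X1,X2) in nats. *)
Definition lratio (a : A) := Q a / (P a.1.1 * marg12 a.1.2 a.2).
(** With z = g(y1) this is P(x, z, y2) / (P(y2) P(x)), whose mean logarithm is I(X;Z1,X2) - H(Z1|X2)
    in nats. *)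
Definition rratio (a : A) :=
  (\sum_(y1 | g y1 == g a.1.2) Q (a.1.1, y1, a.2)) / (marg2 a.2 * P a.1.1).
Definition invP := \sum_x (P x)^-1.

Lemma P_ge0 x : 0 <= P x.
Proof. by rewrite -QP; apply: sumr_ge0 => y1 _; apply: sumr_ge0. Qed.

Lemma marg12_ge0 y1 y2 : 0 <= marg12 y1 y2.
Proof. by apply: sumr_ge0. Qed.

Lemma marg2_ge0 y2 : 0 <= marg2 y2.
Proof. by apply: sumr_ge0 => y1 _; apply: marg12_ge0. Qed.

Lemma cond1_ge0 y2 y1 : 0 <= cond1 y2 y1.
Proof. by rewrite divr_ge0 ?marg12_ge0 ?marg2_ge0. Qed.

Lemma cond12_ge0 x y1 y2 : 0 <= cond12 x y1 y2.
Proof. by rewrite divr_ge0 ?P_ge0. Qed.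

Lemma lratio_ge0 a : 0 <= lratio a.
Proof. by rewrite divr_ge0 ?mulr_ge0 ?P_ge0 ?marg12_ge0. Qed.

Lemma rratio_ge0 a : 0 <= rratio a.
Proof. by rewrite divr_ge0 ?mulr_ge0 ?P_ge0 ?marg2_ge0 ?sumr_ge0. Qed.

Lemma invP_ge0 : 0 <= invP.
Proof. by apply: sumr_ge0 => x _; rewrite invr_ge0 P_ge0. Qed.

Lemma invP_ge x : (P x)^-1 <= invP.
Proof.
by rewrite /invP (bigD1 x) //= lerDl sumr_ge0 // => y _; rewrite invr_ge0 P_ge0.
Qed.

Lemma Q_le_marg12 x y1 y2 : Q (x, y1, y2) <= marg12 y1 y2.
Proof. by rewrite /marg12 (bigD1 x) //= lerDl sumr_ge0. Qed.

Lemma marg12_le_marg2 y1 y2 : marg12 y1 y2 <= marg2 y2.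
Proof. by rewrite /marg2 (bigD1 y1) //= lerDl sumr_ge0 // => y _; apply: marg12_ge0. Qed.

(** If [marg2 y2] vanishes, so does [marg12 y1 y2], and the zero convention of division does no
    harm. *)
Lemma marg2_cond1 y1 y2 : marg2 y2 * cond1 y2 y1 = marg12 y1 y2.
Proof.
rewrite /cond1 mulrCA; have [e|n0] := eqVneq (marg2 y2) 0; last by rewrite divff ?mulr1.
rewrite e mul0r mulr0; apply/esym/eqP; rewrite eq_le marg12_ge0 andbT.
by rewrite -e marg12_le_marg2.
Qed.

Lemma sum_cond1 y2 : marg2 y2 != 0 -> \sum_y1 cond1 y2 y1 = 1.
Proof. by move=> n0; rewrite -big_distrl /= divff. Qed.

(** Change of measure: letters drawn without knowledge of x and weighted by [lratio] follow their
    conditional law given x. *)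
Lemma marg12_lratio x y1 y2 : marg12 y1 y2 * lratio (x, y1, y2) = cond12 x y1 y2.
Proof.
rewrite /lratio /cond12 /= invfM; have [e|n0] := eqVneq (marg12 y1 y2) 0.
  rewrite e mul0r; have -> : Q (x, y1, y2) = 0; last by rewrite mul0r.
  by apply/eqP; rewrite eq_le Q0 andbT -e Q_le_marg12.
by rewrite (mulrC (P x)^-1) !mulrA (mulrC (marg12 _ _)) mulfK.
Qed.

Lemma P_cond12 x y1 y2 : P x * cond12 x y1 y2 = Q (x, y1, y2).
Proof.
rewrite /cond12 mulrCA; have [e|n0] := eqVneq (P x) 0; last by rewrite divff ?mulr1.
rewrite e mul0r mulr0; apply/esym/eqP; rewrite eq_le Q0 andbT -e -QP.
rewrite (bigD1 y1) //= (bigD1 y2) //= -addrA lerDl addr_ge0 ?sumr_ge0 // => y _.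
by apply: sumr_ge0.
Qed.

Lemma sum_cond12 x : \sum_y2 \sum_y1 cond12 x y1 y2 <= 1.
Proof.
rewrite exchange_big /=.
under eq_bigr do rewrite -big_distrl /=.
rewrite -big_distrl /= QP; have [->|n0] := eqVneq (P x) 0; last by rewrite divff.
by rewrite mul0r.
Qed.

Lemma sum_marg2 : \sum_y2 marg2 y2 = 1.
Proof.
rewrite -Q1 sum_triple [RHS]exchange_big /=.
rewrite [RHS](eq_bigr (fun y1 => \sum_y2 marg12 y1 y2)); last by move=> *; exact: exchange_big.
exact: exchange_big.
Qed.

(* A codebook for one value of T0: the node reached by the cribbed prefix
   z^{i-1} carries the Decoder 2 symbol and, for every T1, a Decoder 1 symbol. *)
Fixpoint tree n : finType :=
  if n is n'.+1 then (Y2 * {ffun 'I_M1 -> Y1} * {ffun Z -> tree n'})%type : finType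
  else unit.

Fixpoint treew n : tree n -> R :=
  match n return tree n -> R with
  | 0 => fun=> 1
  | n'.+1 => fun w => marg2 w.1.1 * (\prod_t cond1 w.1.1 (w.1.2 t)) *
                      \prod_z treew (w.2 z)
  end.

(** The branch taken at a node is the value of [g] on the Decoder 1 letter stored there for the
    message. *)
Fixpoint tpath n : tree n -> 'I_M1 -> seq (Y1 * Y2) :=
  match n return tree n -> 'I_M1 -> seq (Y1 * Y2) with
  | 0 => fun _ _ => [::]
  | n'.+1 => fun w t => (w.1.2 t, w.1.1) :: tpath (w.2 (g (w.1.2 t))) t
  end.

Fixpoint tnode n : tree n -> seq Z -> option Y2 :=
  match n return tree n -> seq Z -> option Y2 with
  | 0 => fun _ _ => None
  | n'.+1 => fun w zs => if zs is z :: zs' then tnode (w.2 z) zs' else Some w.1.1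
  end.

Lemma size_tpath n (w : tree n) t : size (tpath w t) = n.
Proof. by elim: n w => //= n IH w; rewrite IH. Qed.

(** The first i cribbed values are the branches that lead to the node visited at time i, so Decoder
    2 finds its letter there before the value at time i is known. *)
Lemma tnode_tpath n (w : tree n) t i y : (i < n)%N ->
  tnode w (take i [seq g p.1 | p <- tpath w t]) = Some (nth y (tpath w t) i).2.
Proof. by elim: n w i => // n IH w [|i] //= ltin; rewrite IH. Qed.

Lemma treew_ge0 n (w : tree n) : 0 <= treew w.
Proof.
elim: n w => //= n IH w; rewrite !mulr_ge0 ?marg2_ge0 ?prodr_ge0 // => t _.
exact: cond1_ge0.
Qed.

Lemma sum_treew n : \sum_(w : tree n) treew w = 1.
Proof.
elim: n => [|n IH]; first by rewrite /= big_const card_unit /= addr0.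
rewrite sum_triple /= -[RHS]sum_marg2; apply: eq_bigr => y2 _.
(* [cond1 y2] has total mass one only if [marg2 y2] is nonzero; otherwise both sides vanish. *)
have [e|n0] := eqVneq (marg2 y2) 0.
  by rewrite e big1 // => u _; rewrite big1 // => c _; rewrite !mul0r.
under eq_bigr do
  rewrite -big_distrr /= -(bigA_distr_bigA (fun _ => @treew n)) IH [X in _ * X]big1 // mulr1.
rewrite -big_distrr /= -(bigA_distr_bigA (fun _ => cond1 y2)) big1 ?mulr1 // => t _.
exact: sum_cond1.
Qed.

(** Letters of the other messages and subtrees off the path sum to one, so a single path sees a root
    pair of law [marg12] and an independent subtree. *)
Lemma sum_tree1 n t (F : Y2 -> Y1 -> tree n -> R) :
  \sum_(w : tree n.+1) treew w * F w.1.1 (w.1.2 t) (w.2 (g (w.1.2 t))) =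
  \sum_y2 \sum_y1 marg12 y1 y2 * \sum_(w : tree n) treew w * F y2 y1 w.
Proof.
rewrite sum_triple /=; apply: eq_bigr => y2 _.
have [e|n0] := eqVneq (marg2 y2) 0.
  rewrite big1; last by move=> u _; rewrite big1 // => c _; rewrite e !mul0r.
  by rewrite big1 // => y1 _; rewrite -marg2_cond1 e !mul0r.
pose G y1 := \sum_(w : tree n) treew w * F y2 y1 w.
transitivity (\sum_(u : {ffun 'I_M1 -> Y1})
    marg2 y2 * ((\prod_t cond1 y2 (u t)) * G (u t))).
  apply: eq_bigr => u _; rewrite /G.
  rewrite -(sum_ffun_prod1 (g (u t)) _ (fun _ => sum_treew n)) !big_distrr /=.
  by apply: eq_bigr => c _; rewrite !mulrA.
rewrite -big_distrr /= (sum_ffun_prod1 t _ (fun _ => sum_cond1 n0)) big_distrr /=.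
by apply: eq_bigr => y1 _; rewrite mulrA marg2_cond1.
Qed.

(** The two paths share y2 and draw y1, y1' independently given it; equal values of [g] send them
    into the same subtree, different values into independent ones. *)
Lemma sum_tree2 n t t' (F : Y2 -> Y1 -> Y1 -> tree n -> tree n -> R) : t != t' ->
  \sum_(w : tree n.+1) treew w * F w.1.1 (w.1.2 t) (w.1.2 t')
     (w.2 (g (w.1.2 t))) (w.2 (g (w.1.2 t'))) =
  \sum_y2 \sum_y1 \sum_y1' marg12 y1 y2 * cond1 y2 y1' *
    (if g y1 == g y1' then \sum_(w : tree n) treew w * F y2 y1 y1' w w
     else \sum_(w : tree n) \sum_(w' : tree n) treew w * treew w' * F y2 y1 y1' w w').
Proof.
move=> tt'; rewrite sum_triple /=; apply: eq_bigr => y2 _.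
have [e|n0] := eqVneq (marg2 y2) 0.
  rewrite big1; last by move=> u _; rewrite big1 // => c _; rewrite e !mul0r.
  rewrite big1 // => y1 _; rewrite big1 // => y1' _.
  by rewrite -marg2_cond1 e !mul0r.
pose G y1 y1' := if g y1 == g y1' then \sum_(w : tree n) treew w * F y2 y1 y1' w w
     else \sum_(w : tree n) \sum_(w' : tree n) treew w * treew w' * F y2 y1 y1' w w'.
transitivity (\sum_(u : {ffun 'I_M1 -> Y1})
    marg2 y2 * ((\prod_t cond1 y2 (u t)) * G (u t) (u t'))).
  apply: eq_bigr => u _; rewrite /G; case: eqVneq => [e|ne].
    rewrite -(sum_ffun_prod1 (g (u t)) _ (fun _ => sum_treew n)) !big_distrr /=.
    by apply: eq_bigr => c _; rewrite !mulrA e.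
  rewrite -(sum_ffun_prod2 _ (fun _ => sum_treew n) ne) !big_distrr /=.
  by apply: eq_bigr => c _; rewrite !mulrA.
rewrite -big_distrr /= (sum_ffun_prod2 _ (fun _ => sum_cond1 n0) tt') big_distrr /=.
apply: eq_bigr => y1 _; rewrite big_distrr; apply: eq_bigr => y1' _ /=.
by rewrite -marg2_cond1 !mulrA.
Qed.

End TreeCode.

(** * Second-moment bound for the random code *)

Lemma exists_le_mean (R : realType) (T : finType) (w F : T -> R) (B : R) :
  (forall t, 0 <= w t) -> \sum_t w t = 1 -> \sum_t w t * F t <= B -> exists t, F t <= B.
Proof.
move=> w0 w1 le; apply: contrapT => /forallNP nc.
have pos t : 0 <= w t * (F t - B).
  by rewrite mulr_ge0 // subr_ge0 ltW // ltNge; apply/negP/nc.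
have s0 : \sum_t w t * (F t - B) = 0.
  apply/eqP; rewrite eq_le sumr_ge0 // andbT.
  under eq_bigr do rewrite mulrBr.
  by rewrite big_split /= sumrN -big_distrl /= w1 mul1r subr_le0.
have wz t : w t = 0.
  have /eqP := psumr_eq0P (fun i _ => pos i) s0 (isT : xpredT t).
  by rewrite mulf_eq0 subr_eq0 => /orP[/eqP//|/eqP e]; case: (nc t); rewrite e.
by move: w1; rewrite big1 // => /eqP; rewrite eq_sym oner_eq0.
Qed.

Section SecondMoment.
Variables (R : realType) (X Y1 Y2 Z : finType) (g : Y1 -> Z).
Variables (P : X -> R) (Q : X * Y1 * Y2 -> R).
Hypothesis Q0 : forall a, 0 <= Q a.
Hypothesis Q1 : \sum_a Q a = 1.
Hypothesis QP : forall x, \sum_y1 \sum_y2 Q (x, y1, y2) = P x.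

Local Notation A := (X * Y1 * Y2)%type.
Implicit Types (xs : seq X) (s : seq A) (phi psi : seq A -> R).

Definition zip3 xs (ys : seq (Y1 * Y2)) : seq A :=
  [seq (p.1, p.2.1, p.2.2) | p <- zip xs ys].

(** The mean of [phi] when (X1, X2) is drawn from its conditional law given the source word [xs];
    the total mass drops to zero if a source letter has probability zero. *)
Fixpoint condsum xs phi : R :=
  if xs is x :: xs' then
    \sum_y2 \sum_y1 cond12 P Q x y1 y2 * condsum xs' (fun s => phi ((x, y1, y2) :: s))
  else phi [::].

Definition Lratio s := \prod_(a <- s) lratio P Q a.

(* Second-moment contribution of the pairs of paths in one tree, see [tree_pair]:
   paths that agree with a given one on exactly k cribbed symbols account for the
   product of its first k factors [rratio], up to the constant [invP]. *)
Definition Rratio s := foldr (fun a v => rratio g P Q a * v + invP P) 1 s.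

Lemma Lratio_ge0 s : 0 <= Lratio s.
Proof. by apply: prodr_ge0 => a _; apply: (lratio_ge0 Q0 QP). Qed.

Lemma Rratio_ge0 s : 0 <= Rratio s.
Proof.
elim: s => //= a s IH.
by rewrite addr_ge0 ?(invP_ge0 Q0 QP) // mulr_ge0 ?(rratio_ge0 _ Q0 QP).
Qed.

Lemma eq_condsum xs phi psi : phi =1 psi -> condsum xs phi = condsum xs psi.
Proof.
elim: xs phi psi => [|x xs IH] phi psi e /=; first exact: e.
apply: eq_bigr => y2 _; apply: eq_bigr => y1 _; congr (_ * _).
by apply: IH => s; rewrite e.
Qed.

Lemma condsumD xs phi psi :
  condsum xs (fun s => phi s + psi s) = condsum xs phi + condsum xs psi.
Proof.
elim: xs phi psi => [//|x xs IH] phi psi /=; rewrite -big_split /=.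
apply: eq_bigr => y2 _; rewrite -big_split /=.
by apply: eq_bigr => y1 _; rewrite IH mulrDr.
Qed.

Lemma condsumZ xs c phi : condsum xs (fun s => c * phi s) = c * condsum xs phi.
Proof.
elim: xs phi => [//|x xs IH] phi /=; rewrite big_distrr /=.
apply: eq_bigr => y2 _; rewrite big_distrr /=.
by apply: eq_bigr => y1 _; rewrite IH mulrCA.
Qed.

Lemma condsum_ge0 xs phi : (forall s, 0 <= phi s) -> 0 <= condsum xs phi.
Proof.
elim: xs phi => [|x xs IH] phi p0 /=; first exact: p0.
apply: sumr_ge0 => y2 _; apply: sumr_ge0 => y1 _.
by rewrite mulr_ge0 ?(cond12_ge0 Q0 QP) // IH.
Qed.

Lemma condsum_le1 xs phi : (forall s, phi s <= 1) -> condsum xs phi <= 1.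
Proof.
elim: xs phi => [|x xs IH] phi p1 /=; first exact: p1.
apply: le_trans (sum_cond12 QP x).
apply: ler_sum => y2 _; apply: ler_sum => y1 _.
by rewrite -[leRHS]mulr1 ler_wpM2l ?(cond12_ge0 Q0 QP) // IH.
Qed.

Lemma seqsum_condsum n phi : seqsum P n (fun xs => condsum xs phi) = seqsum Q n phi.
Proof.
elim: n phi => [//|n IH] phi /=; rewrite sum_triple; apply: eq_bigr => x _.
rewrite seqsum_sum [RHS]exchange_big big_distrr /=; apply: eq_bigr => y2 _.
rewrite seqsum_sum big_distrr /=; apply: eq_bigr => y1 _.
by rewrite seqsumZ IH mulrA (P_cond12 Q0 QP).
Qed.

Variable M1 : nat.
Local Notation tree := (tree Y1 Y2 Z M1).

(** [marg12_lratio] applied along the path: the weight [Lratio] turns the law of a codeword into the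
    conditional law given [xs]. *)
Lemma tree_mean n xs t phi : size xs = n ->
  \sum_(w : tree n) treew Q w *
    (Lratio (zip3 xs (tpath g w t)) * phi (zip3 xs (tpath g w t))) =
  condsum xs phi.
Proof.
elim: n xs phi => [|n IH] [|x xs] phi //=.
  by move=> _; rewrite big_const card_unit /= addr0 mul1r /Lratio big_nil mul1r.
case=> sx; rewrite (sum_tree1 g Q0 Q1 t (fun y2 y1 (w : tree n) =>
  Lratio ((x, y1, y2) :: zip3 xs (tpath g w t)) *
  phi ((x, y1, y2) :: zip3 xs (tpath g w t)))).
apply: eq_bigr => y2 _; apply: eq_bigr => y1 _.
rewrite -(marg12_lratio P Q0) -mulrA; congr (_ * _); rewrite -(IH _ _ sx) big_distrr /=.
by apply: eq_bigr => w _; rewrite /Lratio big_cons; ring.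
Qed.

(** The matching letters y1' sum to [rratio] exactly. All letters together sum to at most 1/P(x),
    which bounds the part where the paths separate. *)
Lemma sum_match_le x y1 y2 (u v : R) : 0 <= u -> 0 <= v ->
  \sum_y1' cond1 Q y2 y1' * lratio P Q (x, y1', y2) * (if g y1 == g y1' then u else v)
  <= rratio g P Q (x, y1, y2) * u + invP P * v.
Proof.
move=> u0 v0; have lE y : cond1 Q y2 y * lratio P Q (x, y, y2) =
    Q (x, y, y2) / (marg2 Q y2 * P x).
  rewrite /cond1 mulrAC (marg12_lratio P Q0) /cond12 invfM -mulrA.
  by rewrite (mulrC (P x)^-1).
have l0 y : 0 <= cond1 Q y2 y * lratio P Q (x, y, y2).
  by rewrite mulr_ge0 ?cond1_ge0 ?(lratio_ge0 Q0 QP).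
rewrite (bigID (fun y => g y == g y1)) /= lerD //.
  rewrite /rratio /= -mulrA big_distrl /= le_eqVlt; apply/orP; left; apply/eqP.
  by apply: eq_bigr => y /eqP->; rewrite eqxx lE mulrA.
apply: (@le_trans _ _ (\sum_y cond1 Q y2 y * lratio P Q (x, y, y2) * v)).
  rewrite [leRHS](bigID (fun y => g y == g y1)) /= -[leLHS]add0r lerD //.
    by apply: sumr_ge0 => y _; rewrite mulr_ge0.
  by apply: ler_sum => y /negbTE; rewrite eq_sym => ->.
rewrite -big_distrl /= ler_wpM2r // (eq_bigr _ (fun y _ => lE y)) -big_distrl /=.
have [e|n0] := eqVneq (marg2 Q y2) 0.
  by rewrite e mul0r invr0 mulr0 (invP_ge0 Q0 QP).
apply: le_trans (invP_ge Q0 QP x); rewrite invfM mulrA ler_piMl ?invr_ge0 ?(P_ge0 Q0 QP) //.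
rewrite ler_pdivrMr ?mul1r; last by rewrite lt_neqAle eq_sym n0 marg2_ge0.
by apply: ler_sum => y _; apply: Q_le_marg12.
Qed.

(** Induction on the depth. A second path that stays with the first contributes [rratio] times the
    same quantity one level down; one that leaves contributes at most [invP] times the mean over the
    rest of the first path. *)
Lemma tree_pair n xs t t' phi : size xs = n -> t != t' -> (forall s, 0 <= phi s) ->
  \sum_(w : tree n) treew Q w *
    (Lratio (zip3 xs (tpath g w t)) * phi (zip3 xs (tpath g w t)) *
     Lratio (zip3 xs (tpath g w t'))) <=
  condsum xs (fun s => phi s * Rratio s).
Proof.
move=> + tt'; elim: n xs phi => [|n IH] [|x xs] phi //=.
  by move=> _ _; rewrite big_const card_unit /= addr0 /Lratio !big_nil !mul1r mulr1.
case=> sx p0.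
pose F y2 y1 y1' (w w' : tree n) :=
  Lratio ((x, y1, y2) :: zip3 xs (tpath g w t)) *
  phi ((x, y1, y2) :: zip3 xs (tpath g w t)) *
  Lratio ((x, y1', y2) :: zip3 xs (tpath g w' t')).
rewrite (sum_tree2 g Q0 Q1 F tt').
apply: ler_sum => y2 _; apply: ler_sum => y1 _.
pose phi' s := phi ((x, y1, y2) :: s).
pose u := condsum xs (fun s => phi' s * Rratio s).
pose v := condsum xs phi'.
have u0 : 0 <= u by apply: condsum_ge0 => s; rewrite mulr_ge0 ?Rratio_ge0 ?p0.
have v0 : 0 <= v by apply: condsum_ge0 => s; apply: p0.
rewrite (_ : condsum xs _ = rratio g P Q (x, y1, y2) * u + invP P * v); last first.
  rewrite -!condsumZ -condsumD; apply: eq_condsum => s /=; rewrite /phi'; ring.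
rewrite -(marg12_lratio P Q0) -mulrA.
apply: le_trans (ler_wpM2l _ (ler_wpM2l _ (sum_match_le x y1 y2 u0 v0)));
  rewrite ?marg12_ge0 ?(lratio_ge0 Q0 QP) //.
rewrite !big_distrr /=; apply: ler_sum => y1' _.
rewrite -mulrA; apply: ler_wpM2l; first exact: marg12_ge0.
rewrite [leRHS](_ : _ = cond1 Q y2 y1' * (lratio P Q (x, y1, y2) *
  (lratio P Q (x, y1', y2) * (if g y1 == g y1' then u else v)))); last by ring.
apply: ler_wpM2l; first exact: cond1_ge0.
case: eqP => _.
  rewrite [leRHS]mulrA; apply: le_trans (ler_wpM2l _ (IH xs phi' sx _)); last first.
  - by move=> s; apply: p0.
  - by rewrite mulr_ge0 ?(lratio_ge0 Q0 QP).
  rewrite big_distrr /= le_eqVlt; apply/orP; left; apply/eqP.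
  apply: eq_bigr => w _; rewrite /F /Lratio !big_cons /phi'; ring.
(* The subtrees are independent: the mean factors, and the factor of the second path is at most
   one. *)
rewrite [leRHS]mulrA (_ : \sum_w _ = lratio P Q (x, y1, y2) * lratio P Q (x, y1', y2) *
    (v * condsum xs (fun=> 1))).
  apply: ler_wpM2l; first by rewrite mulr_ge0 ?(lratio_ge0 Q0 QP).
  by rewrite ler_piMr // condsum_le1.
rewrite /v -(tree_mean t phi' sx) -(tree_mean t' (fun=> 1) sx).
rewrite big_distrlr big_distrr /=; apply: eq_bigr => w _; rewrite big_distrr /=.
apply: eq_bigr => w' _; rewrite /F /Lratio !big_cons /phi'; ring.
Qed.

Variable M0 : nat.

Definition codew n (c : {ffun 'I_M0 -> tree n}) : R := \prod_i treew Q (c i).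

Lemma codew_ge0 n (c : {ffun 'I_M0 -> tree n}) : 0 <= codew c.
Proof. by apply: prodr_ge0 => i _; apply: treew_ge0. Qed.

Lemma sum_codew n : \sum_(c : {ffun 'I_M0 -> tree n}) codew c = 1.
Proof.
rewrite -(bigA_distr_bigA (fun _ => @treew R X Y1 Y2 Z M1 Q n)).
by rewrite big1 // => i _; apply: (sum_treew Z M1 Q1).
Qed.

Section Miss.
Variables (n : nat) (xs : seq X) (typ : seq A -> bool).
Hypothesis sx : size xs = n.
Hypotheses (M0_gt0 : (0 < M0)%N) (M1_gt0 : (0 < M1)%N).

Local Notation codeword c i t := (zip3 xs (tpath g (c i) t)).
Local Notation hit s := (Lratio s * (typ s)%:R).

Definition found (c : {ffun 'I_M0 -> tree n}) :=
  [exists i, [exists t, typ (codeword c i t)]].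

Let ER := condsum xs (fun s => (typ s)%:R * Rratio s).
Let EL := condsum xs (fun s => (typ s)%:R * Lratio s).

Lemma code_mean i t :
  \sum_(c : {ffun 'I_M0 -> tree n}) codew c * hit (codeword c i t) =
  condsum xs (fun s => (typ s)%:R).
Proof.
have w1 (j : 'I_M0) : \sum_(w : tree n) treew Q w = 1 := sum_treew Z M1 Q1 n.
rewrite [LHS](sum_ffun_prod1 i (fun w : tree n => hit (zip3 xs (tpath g w t))) w1).
exact: tree_mean.
Qed.

(** Paths in different trees are independent. In one tree, distinct messages fall under [tree_pair],
    and a path paired with itself keeps one factor [Lratio] after the change of measure. *)
Lemma code_pair i t i' t' :
  \sum_(c : {ffun 'I_M0 -> tree n}) codew c *
     (hit (codeword c i t) * hit (codeword c i' t')) <=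
  1 + (i == i')%:R * (ER + (t == t')%:R * EL).
Proof.
have ER0 : 0 <= ER by apply: condsum_ge0 => s; rewrite mulr_ge0 ?Rratio_ge0.
have EL0 : 0 <= EL by apply: condsum_ge0 => s; rewrite mulr_ge0 ?Lratio_ge0.
have w1 (j : 'I_M0) := sum_treew Z M1 Q1 n : \sum_(w : tree n) treew Q w = 1.
have c0 : 0 <= condsum xs (fun s => (typ s)%:R) by apply: condsum_ge0.
have c1 : condsum xs (fun s => (typ s)%:R) <= 1.
  by apply: condsum_le1 => s; case: typ.
have [<-{i'}|ii'] := eqVneq i i'; last first.
  rewrite mul0r addr0.
  rewrite [leLHS](sum_ffun_prod2 (fun w w' : tree n => hit (zip3 xs (tpath g w t)) *
    hit (zip3 xs (tpath g w' t'))) w1 ii').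
  rewrite (_ : \sum_w _ = condsum xs (fun s => (typ s)%:R) * condsum xs (fun s => (typ s)%:R)).
    by rewrite mulr_ile1.
  rewrite -{1}(tree_mean t _ sx) -(tree_mean t' _ sx) big_distrlr /=.
  by apply: eq_bigr => w _; apply: eq_bigr => w' _; rewrite mulrACA.
rewrite mul1r.
rewrite [leLHS](sum_ffun_prod1 i (fun w : tree n => hit (zip3 xs (tpath g w t)) *
    hit (zip3 xs (tpath g w t'))) w1).
have [<-{t'}|tt'] := eqVneq t t'; last first.
  rewrite mul0r addr0.
  apply: (@le_trans _ _ ER); last by rewrite lerDr.
  apply: le_trans (tree_pair sx tt' _); last by [].
  apply: ler_sum => w _; rewrite ler_wpM2l ?treew_ge0 //.
  rewrite ler_wpM2l ?mulr_ge0 ?Lratio_ge0 //.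
  by rewrite -[leRHS]mulr1 ler_wpM2l ?Lratio_ge0 //; case: typ.
rewrite mul1r; apply: (@le_trans _ _ EL); last first.
  by rewrite -[leLHS]add0r addrA lerD // addr_ge0.
rewrite /EL -(tree_mean t _ sx); apply: ler_sum => w _.
rewrite ler_wpM2l ?treew_ge0 // le_eqVlt; apply/orP; left; apply/eqP.
by case: typ; rewrite ?mulr1n ?mulr0n; ring.
Qed.

Lemma code_miss :
  \sum_(c : {ffun 'I_M0 -> tree n}) codew c * (~~ found c)%:R <=
  2 * (1 - condsum xs (fun s => (typ s)%:R)) + M0%:R^-1 * ER + (M0%:R * M1%:R)^-1 * EL.
Proof.
set p := condsum xs _.
set m0 : R := M0%:R; set m1 : R := M1%:R.
have m0n : m0 != 0 by rewrite pnatr_eq0 -lt0n.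
have m1n : m1 != 0 by rewrite pnatr_eq0 -lt0n.
pose N (c : {ffun 'I_M0 -> tree n}) := (m0 * m1)^-1 * \sum_i \sum_t hit (codeword c i t).
(* If no codeword is typical, [N c] is zero and the square equals one. *)
apply: (@le_trans _ _ (\sum_c codew c * (N c - 1) ^+ 2)).
  apply: ler_sum => c _; rewrite ler_wpM2l ?codew_ge0 //.
  case: (boolP (found c)) => [_|nf]; first exact: sqr_ge0.
  rewrite /N big1 ?mulr0 ?sub0r ?sqrrN ?expr1n // => i _; rewrite big1 // => t _.
  move: nf; rewrite negb_exists => /forallP/(_ i); rewrite negb_exists => /forallP/(_ t).
  by move=> /negbTE->; rewrite mulr0.
have EN : \sum_c codew c * N c = p.
  under eq_bigr => c _.
    rewrite /N mulrCA big_distrr /=; under eq_bigr do rewrite big_distrr /=; over.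
  rewrite -big_distrr /= exchange_big /=.
  rewrite (eq_bigr (fun=> m1 * p)); last first.
    move=> i _; rewrite exchange_big /= (eq_bigr (fun=> p)); last by move=> t _; apply: code_mean.
    by rewrite big_const card_ord iter_addr_0 mulr_natl.
  rewrite big_const card_ord iter_addr_0 -mulr_natl -/m0; field.
  by rewrite m0n m1n.
have EN2 : \sum_c codew c * N c ^+ 2 <= 1 + m0^-1 * ER + (m0 * m1)^-1 * EL.
  rewrite (eq_bigr (fun c => (m0 * m1)^-1 ^+ 2 * \sum_i \sum_t \sum_i' \sum_t'
      codew c * (hit (codeword c i t) * hit (codeword c i' t')))); last first.
    move=> c _; rewrite /N exprMn mulrCA; congr (_ * _).
    rewrite expr2 big_distrlr /= big_distrr /=; apply: eq_bigr => i _.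
    under eq_bigr do rewrite big_distrlr /=.
    rewrite exchange_big big_distrr /=; apply: eq_bigr => t _.
    rewrite big_distrr /=; apply: eq_bigr => i' _.
    by rewrite big_distrr.
  rewrite -big_distrr /= exchange_big /=.
  apply: (@le_trans _ _ ((m0 * m1)^-1 ^+ 2 *
      \sum_(i < M0) \sum_(t < M1) \sum_(i' < M0) \sum_(t' < M1) (1 + (i == i')%:R * (ER + (t == t')%:R * EL)))).
    rewrite ler_wpM2l ?exprn_ge0 ?invr_ge0 ?mulr_ge0 ?ler0n //.
    apply: ler_sum => i _; rewrite exchange_big; apply: ler_sum => t _ /=.
    rewrite exchange_big; apply: ler_sum => i' _ /=.
    rewrite exchange_big; apply: ler_sum => t' _ /=.
    exact: code_pair.
  (* Of the (m0 m1)^2 pairs, m0 m1^2 lie in a common tree and m0 m1 are equal. *)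
  rewrite le_eqVlt; apply/orP; left; apply/eqP.
  have dE k (j : 'I_k) (b : R) : \sum_(j' < k) (j == j')%:R * b = b.
    rewrite (bigD1 j) //= eqxx mul1r big1 ?addr0 // => j' /negbTE.
    by rewrite eq_sym => ->; rewrite mul0r.
  have cE k (b : R) : \sum_(j' < k) b = k%:R * b.
    by rewrite big_const card_ord iter_addr_0 mulr_natl.
  rewrite (eq_bigr (fun=> m1 * (m0 * m1 + m1 * ER + EL))).
    by rewrite cE -/m0; field; rewrite m0n m1n.
  move=> i _; rewrite (eq_bigr (fun=> m0 * m1 + m1 * ER + EL)) ?cE // => t _.
  rewrite (eq_bigr (fun i' => m1 + (i == i')%:R * (m1 * ER + EL))).
    by rewrite big_split /= dE cE addrA.
  move=> i' _; rewrite big_split /= cE mulr1; congr (_ + _).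
  by rewrite -big_distrr big_split /= dE cE.
rewrite (eq_bigr (fun c => codew c * N c ^+ 2 + - 2 * (codew c * N c) + codew c)); last first.
  move=> c _; ring.
rewrite !big_split /= -big_distrr /= EN sum_codew; lra.
Qed.

End Miss.

(** The bound of [code_miss] is averaged over the source word before the code is chosen, so one code
    serves all words; the conditional means become means under [Q]. *)
Lemma exists_code n typ : (0 < M0)%N -> (0 < M1)%N ->
  exists c : {ffun 'I_M0 -> tree n},
  seqsum P n (fun xs => (~~ found xs typ c)%:R) <=
    2 * (1 - seqsum Q n (fun s => (typ s)%:R)) +
    M0%:R^-1 * seqsum Q n (fun s => (typ s)%:R * Rratio s) +
    (M0%:R * M1%:R)^-1 * seqsum Q n (fun s => (typ s)%:R * Lratio s).
Proof.
move=> m0 m1; apply: (exists_le_mean (@codew_ge0 n) (sum_codew n)).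
have P0 := P_ge0 Q0 QP.
have P1 : \sum_x P x = 1.
  by rewrite -Q1 sum_triple; apply: eq_bigr => x _; rewrite QP.
under eq_bigr do rewrite -seqsumZ.
rewrite -seqsum_sum.
apply: le_trans (le_seqsum P0 (fun xs sx => code_miss typ sx m0 m1)) _.
rewrite !seqsumD !seqsumZ seqsumD seqsum1 //.
have -> : seqsum P n (fun xs => - condsum xs (fun s => (typ s)%:R)) =
    -1 * seqsum P n (fun xs => condsum xs (fun s => (typ s)%:R)).
  by rewrite -seqsumZ; apply: eq_seqsum => xs _; rewrite mulN1r.
by rewrite !seqsum_condsum mulN1r.
Qed.

End SecondMoment.

(** * Exponential tail bounds *)

Section LargeDeviations.
Variable R : realType.

(** From exp(-y) >= 1 - y follows (1 - y) exp(y) <= 1, while (1 - y)(1 + y + 2 y^2) = 1 + y^2 (1 - 2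
    y) >= 1. *)
Lemma expR_le_quad (y : R) : y <= 2^-1 -> expR y <= 1 + y + 2 * y ^+ 2.
Proof.
move=> yh; have := expR_ge1Dx (- y); rewrite expRN => ye.
have e0 := expR_gt0 y.
have : (1 - y) * expR y <= 1 by rewrite -ler_pdivlMr // div1r.
have : 0 <= y ^+ 2 * (1 - 2 * y) by rewrite mulr_ge0 ?sqr_ge0 //; lra.
move=> h1 h2; rewrite -(ler_pM2l (_ : 0 < 1 - y)); last lra.
apply: le_trans h2 _; nra.
Qed.

Lemma lin_expRN_small (K kappa eps : R) : 0 <= K -> 0 < kappa -> 0 < eps ->
  \forall n \near \oo, (K * n%:R + 1) * expR (- (n%:R * kappa)) <= eps.
Proof.
(* For n >= 1 and n >= L, K n + 1 <= (K + 1) n <= eps (n kappa)^2 / 2, and exp(x) >= x^2 / 2. *)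
move=> K0 k0 e0; pose L := 2 * (K + 1) / (kappa ^+ 2 * eps).
near=> n.
have n1 : 1 <= n%:R :> R by rewrite ler1n; near: n; exists 1%N.
have nL : L <= n%:R.
  apply: (@le_trans _ _ (Num.truncn L).+1%:R); first exact/ltW/truncnS_gt.
  by rewrite ler_nat; near: n; exists (Num.truncn L).+1.
have x0 : 0 <= n%:R * kappa by rewrite mulr_ge0 // ltW.
have := expR_ge1Dxn 1 x0; rewrite (_ : 2`! = 2)%N // => h.
rewrite expRN ler_pdivrMr ?expR_gt0 //.
have ke : 0 < kappa ^+ 2 * eps by rewrite mulr_gt0 // exprn_gt0.
move: nL; rewrite /L ler_pdivrMr // => nL.
have {}h : (n%:R * kappa) ^+ 2 / 2 <= expR (n%:R * kappa) by lra.
apply: le_trans (ler_wpM2l (ltW e0) h).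
rewrite mulrA ler_pdivlMr // exprMn.
apply: (@le_trans _ _ (n%:R * (2 * (K + 1)))).
  by nra.
by apply: le_trans (ler_wpM2l _ nL) _; rewrite ?ler0n //; nra.
Unshelve. all: by end_near. Qed.

Variables (A : finType) (Q : A -> R).
Hypotheses (Q0 : forall a, 0 <= Q a) (Q1 : \sum_a Q a = 1).

Lemma chernoff (f : A -> R) (c : R) : \sum_a Q a * f a < c ->
  exists t k : R, [/\ 0 < t, 0 < k & \sum_a Q a * expR (t * (f a - c)) <= expR (- k)].
Proof.
move=> fc; pose d := c - \sum_a Q a * f a; have d0 : 0 < d by rewrite subr_gt0.
pose B := 1 + \sum_a `|f a - c|.
have S0 : 0 <= \sum_a `|f a - c| by apply: sumr_ge0.
have B1 : 1 <= B by rewrite lerDl.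
have fB a : `|f a - c| <= B.
  by rewrite /B (bigD1 a) //= addrCA lerDl addr_ge0 ?sumr_ge0.
(* With t = d / D, t B <= 1/2 makes the quadratic estimate available, and 2 t B^2 <= d / 2 lets the
   second-order term consume at most half of the drift t d. *)
pose D := 4 * B ^+ 2 + 2 * B * d; have Bp : 0 < B by lra.
have D0 : 0 < D by rewrite /D addr_gt0 ?mulr_gt0 ?exprn_gt0.
pose t := d / D; have t0 : 0 < t by rewrite divr_gt0.
have tD : t * D = d by rewrite /t -mulrA mulVf ?mulr1 // gt_eqF.
have td0 : 0 < t * d by apply: mulr_gt0.
exists t, (t * d / 2); split=> //; first by lra.
apply: le_trans (expR_ge1Dx _).
have tB : t * B <= 2^-1 by rewrite -(ler_pM2r D0); rewrite mulrAC tD /D; nra.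
have tB2 : 2 * t * B ^+ 2 <= d / 2.
  rewrite -(ler_pM2r D0) (_ : _ * D = 2 * B ^+ 2 * (t * D)); last by ring.
  by rewrite tD /D; nra.
have pt a : Q a * expR (t * (f a - c)) <= Q a + t * (Q a * f a - c * Q a) + t * (d / 2) * Q a.
  rewrite [leRHS](_ : _ = Q a * (1 + t * (f a - c) + t * (d / 2))); last by ring.
  rewrite ler_wpM2l //.
  have y1 : f a - c <= B by apply: le_trans (ler_norm _) _.
  have y2 : (f a - c) ^+ 2 <= B ^+ 2.
    by rewrite -real_normK ?num_real // ler_sqr ?nnegrE ?fB // ltW // (lt_le_trans ltr01).
  apply: le_trans (expR_le_quad _) _.
    by apply: le_trans tB; rewrite ler_pM2l.
  rewrite lerD2l exprMn; apply: (@le_trans _ _ (2 * t ^+ 2 * B ^+ 2)).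
    by rewrite mulrA ler_wpM2l // mulr_ge0 // sqr_ge0.
  by rewrite (_ : _ * B ^+ 2 = t * (2 * t * B ^+ 2)) ?ler_wpM2l ?(ltW t0) //; last by ring.
apply: le_trans (ler_sum _ (fun a _ => pt a)) _.
rewrite !big_split /= -!big_distrr /= big_split /= sumrN -big_distrr /= Q1.
rewrite (_ : \sum_a Q a * f a = c - d); last by rewrite /d; ring.
by rewrite le_eqVlt; apply/orP; left; apply/eqP; field.
Qed.

Lemma tail_sum (f : A -> R) (c : R) : \sum_a Q a * f a < c ->
  exists2 k : R, 0 < k & forall n,
    seqsum Q n (fun s => (~~ (\sum_(a <- s) f a <= n%:R * c))%:R) <= expR (- (n%:R * k)).
Proof.
move=> /chernoff[t [k [t0 k0 h]]]; exists k => // n.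
apply: (@le_trans _ _ (seqsum Q n (fun s => expR (\sum_(a <- s) t * (f a - c))))).
  apply: le_seqsum => // s ss; case: (lerP (\sum_(a <- s) f a)) => [_|lt] /=; first exact: expR_ge0.
  rewrite mulr1n.
  rewrite -expR0 ler_expR -big_distrr mulr_ge0 ?(ltW t0) //= big_split /= sumrN.
  rewrite (_ : \sum_(a <- s) c = n%:R * c) ?subr_ge0 ?ltW //.
  by rewrite big_const_seq count_predT ss iter_addr_0 mulr_natl.
rewrite seqsum_expR -mulrN expRM_natl.
by apply: lerXn2r; rewrite ?nnegrE ?expR_ge0 // sumr_ge0 // => a _; rewrite mulr_ge0 ?expR_ge0.
Qed.

(* The maximum of the partial sums of [f - c] over the prefixes of [s], and 0. *)
Definition prefmax (f : A -> R) (c : R) (s : seq A) : R :=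
  foldr (fun a v => Num.max 0 (f a - c + v)) 0 s.

(** Markov's inequality for exp(t prefmax). Since exp(max(0, u)) <= 1 + exp(u) and exp(t (f - c))
    has mean at most one, each letter raises this moment by at most one. *)
Lemma tail_prefmax (f : A -> R) (c d : R) : \sum_a Q a * f a < c -> 0 < d ->
  exists2 k : R, 0 < k & forall n,
    seqsum Q n (fun s => (~~ (prefmax f c s <= n%:R * d))%:R) <=
    (n%:R + 1) * expR (- (n%:R * k)).
Proof.
move=> /chernoff[t [k [t0 k0 h]]] d0; exists (t * d) => [|n]; first exact: mulr_gt0.
apply: (@le_trans _ _ (seqsum Q n (fun s =>
    expR (- (n%:R * (t * d))) * expR (t * prefmax f c s)))).
  apply: le_seqsum => // s ss; case: (lerP (prefmax f c s)) => [_|lt] /=.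
    by rewrite mulr_ge0 ?expR_ge0.
  rewrite mulr1n.
  rewrite -expRD -expR0 ler_expR mulrCA -mulrN -mulrDr mulr_ge0 ?(ltW t0) //.
  by rewrite expR0 addrC subr_ge0 ltW.
rewrite seqsumZ mulrC ler_wpM2r ?expR_ge0 //.
elim: n => [|n IH] /=; first by rewrite /prefmax /= mulr0 expR0 add0r.
apply: (@le_trans _ _ (\sum_a Q a * (1 + expR (t * (f a - c)) * (n%:R + 1)))).
  apply: ler_sum => a _; rewrite ler_wpM2l //.
  apply: le_trans (_ : 1 + expR (t * (f a - c)) *
    seqsum Q n (fun s => expR (t * prefmax f c s)) <= _); last first.
    by rewrite lerD2l ler_wpM2l ?expR_ge0.
  rewrite -seqsumZ -{1}(seqsum1 n Q1) -seqsumD; apply: le_seqsum => // s _.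
  rewrite {1}/prefmax /= -/(prefmax f c s) -expRD -mulrDr maxr_pMr ?(ltW t0) // mulr0.
  by case: (leP 0) => _; rewrite ?expR0 ?lerDr ?lerDl ?expR_ge0.
under eq_bigr do rewrite mulrDr mulr1 mulrA.
rewrite big_split /= Q1 -big_distrl /= -natr1 addrC lerD2r.
rewrite -[leRHS]mul1r ler_wpM2r ?addr_ge0 //.
by apply: le_trans h _; rewrite expR_le1 oppr_le0 ltW.
Qed.

(** Unfolded, the left side sums the products of the first k values of [r], with coefficient [C] for
    k < size s and one for the full product. Each product is at most exp(k c + prefmax). *)
Lemma foldr_le_prefmax (r f : A -> R) (C c : R) s :
  (forall a, 0 <= r a <= expR (f a)) -> 0 <= C -> 0 <= c ->
  foldr (fun a v => r a * v + C) 1 s <=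
  (C * (size s)%:R + 1) * expR ((size s)%:R * c + prefmax f c s).
Proof.
move=> rf C0 c0; elim: s => [|a s IH] /=.
  by rewrite mulr0 mul0r !add0r expR0 mulr1.
set v := foldr _ _ _ in IH *.
have v0 : 0 <= v.
  rewrite /v; elim: (s) => //= b s' v0; have /andP[r0 _] := rf b.
  by rewrite addr_ge0 ?mulr_ge0.
set m := Num.max _ _.
have m1 : f a - c + prefmax f c s <= m by rewrite le_max lexx orbT.
have m0 : 0 <= m by rewrite le_max lexx.
have K0 : 0 <= C * (size s)%:R + 1 by rewrite addr_ge0 ?mulr_ge0.
apply: (@le_trans _ _ ((C * (size s)%:R + 1) * expR ((size s).+1%:R * c + m) +
   C * expR ((size s).+1%:R * c + m))); last first.
  by rewrite -natr1 -mulrDl le_eqVlt; apply/orP; left; apply/eqP; ring.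
rewrite lerD //; last first.
  by rewrite ler_peMr // -expR0 ler_expR addr_ge0 ?mulr_ge0.
apply: (@le_trans _ _ (expR (f a) * ((C * (size s)%:R + 1) *
     expR ((size s)%:R * c + prefmax f c s)))).
  apply: (@le_trans _ _ (expR (f a) * v)); last by rewrite ler_wpM2l ?expR_ge0.
  by have /andP[r0 re] := rf a; rewrite ler_wpM2r.
rewrite mulrCA ler_wpM2l // -expRD ler_expR -natr1; lra.
Qed.

End LargeDeviations.

(** * Entropies as mean log-likelihoods *)

Section Information.
Variable R : realType.

Lemma ln2_gt0 : 0 < ln 2 :> R.
Proof. by rewrite ln_gt0 // ltr1n. Qed.

Lemma sum_pushforward (T U : finType) (p : T -> R) (f : T -> U) (F : U -> R) :
  \sum_u Defs.pushforward p f u * F u = \sum_t p t * F (f t).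
Proof.
rewrite (partition_big f xpredT) //=; apply: eq_bigr => u _.
by rewrite /Defs.pushforward big_distrl /=; apply: eq_bigr => t /eqP->.
Qed.

Lemma pushforward_ge0 (T U : finType) (p : T -> R) (f : T -> U) u :
  (forall t, 0 <= p t) -> 0 <= Defs.pushforward p f u.
Proof. by move=> p0; apply: sumr_ge0. Qed.

Lemma pushforward_ge (T U : finType) (p : T -> R) (f : T -> U) t :
  (forall t, 0 <= p t) -> p t <= Defs.pushforward p f (f t).
Proof. by move=> p0; rewrite /Defs.pushforward (bigD1 t) //= lerDl sumr_ge0. Qed.

(** As means over the base space, entropies of different maps combine under one sum. *)
Lemma ent_ln (T U : finType) (p : T -> R) (f : T -> U) :
  ent p f = - (\sum_t p t * ln (Defs.pushforward p f (f t))) / ln 2.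
Proof.
rewrite /ent /entropy mulNr; congr (- _).
rewrite -(sum_pushforward p f (fun u => ln (Defs.pushforward p f u))) big_distrl /=.
by apply: eq_bigr => u _; case: eqP => [->|_]; rewrite ?mul0r // mulrA.
Qed.

Variables (X Y1 Y2 Z : finType) (g : Y1 -> Z).
Variable Q : X * Y1 * Y2 -> R.

Lemma pushforwardX x :
  Defs.pushforward Q (fun t => t.1.1) x = \sum_y1 \sum_y2 Q (x, y1, y2).
Proof.
rewrite /Defs.pushforward big_mkcond sum_triple (bigD1 x) //= eqxx.
rewrite [X in _ + X]big1 ?addr0 // => x' /negbTE->.
by rewrite big1 // => y1 _; rewrite big1.
Qed.

Lemma pushforward12 y1 y2 :
  Defs.pushforward Q (fun t => (t.1.2, t.2)) (y1, y2) = marg12 Q y1 y2.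
Proof.
rewrite /Defs.pushforward big_mkcond sum_triple /=; apply: eq_bigr => x _.
rewrite (bigD1 y1) //= (bigD1 y2) //= eqxx.
rewrite [X in _ + X + _]big1 => [|y /negbTE ny]; last by rewrite xpair_eqE ny andbF.
rewrite [X in _ + X]big1 ?addr0 // => y /negbTE ny.
by rewrite big1 // => y' _; rewrite xpair_eqE ny.
Qed.

Lemma pushforward2 y2 : Defs.pushforward Q (fun t => t.2) y2 = marg2 Q y2.
Proof.
rewrite /Defs.pushforward big_mkcond sum_triple /marg2 exchange_big /=.
apply: eq_bigr => y1 _; apply: eq_bigr => x _.
rewrite (bigD1 y2) //= eqxx big1 ?addr0 // => y /negbTE->.
by [].
Qed.

Lemma pushforwardXZ2 a :
  Defs.pushforward Q (fun t => (t.1.1, (g t.1.2, t.2))) (a.1.1, (g a.1.2, a.2)) =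
  \sum_(y1 | g y1 == g a.1.2) Q (a.1.1, y1, a.2).
Proof.
rewrite /Defs.pushforward big_mkcond sum_triple (bigD1 a.1.1) //=.
rewrite [X in _ + X]big1 ?addr0.
  rewrite [RHS]big_mkcond; apply: eq_bigr => y1 _.
  rewrite (bigD1 a.2) //= !xpair_eqE !eqxx andbT /= big1 ?addr0 // => y2 /negbTE ny.
  by rewrite !xpair_eqE ny !andbF.
move=> x /negbTE nx; rewrite big1 // => y1 _; rewrite big1 // => y2 _.
by rewrite xpair_eqE nx.
Qed.

Lemma pushforward_id a :
  Defs.pushforward Q (fun t => (t.1.1, (t.1.2, t.2))) (a.1.1, (a.1.2, a.2)) = Q a.
Proof.
rewrite /Defs.pushforward (big_pred1 a) // => -[[x y1] y2].
by case: a => -[x' y1'] y2' /=; rewrite !xpair_eqE andbA.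
Qed.

Variable P : X -> R.
Hypothesis Q0 : forall a, 0 <= Q a.
Hypothesis QP : forall x, \sum_y1 \sum_y2 Q (x, y1, y2) = P x.

Lemma sum_ln_lratio :
  \sum_a Q a * ln (lratio P Q a) =
  ln 2 * mutual_info Q (fun t => t.1.1) (fun t => (t.1.2, t.2)).
Proof.
have l2 := lt0r_neq0 ln2_gt0.
rewrite /mutual_info !ent_ln -!mulrDl -mulNr opprK -mulrDl mulrC divfK //.
rewrite -!sumrN -!big_split /=; apply: eq_bigr => -[[x y1] y2] _ /=.
rewrite (pushforward_id (x, y1, y2)) pushforwardX QP pushforward12 /lratio /=.
(* Null triples contribute nothing; at the others all marginals are positive and the logarithms
   split. *)
have [->|nz] := eqVneq (Q (x, y1, y2)) 0; first by rewrite !mul0r; ring.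
have q0 : 0 < Q (x, y1, y2) by rewrite lt_neqAle eq_sym nz Q0.
have m0 : 0 < marg12 Q y1 y2 by apply: lt_le_trans q0 (Q_le_marg12 Q0 _ _ _).
have p0 : 0 < P x.
  apply: lt_le_trans q0 _; rewrite -QP -(pushforwardX x).
  exact: (pushforward_ge (fun t => t.1.1) (x, y1, y2) Q0).
by rewrite ln_div ?posrE ?mulr_gt0 // lnM ?posrE //; ring.
Qed.

Lemma sum_ln_rratio :
  \sum_a Q a * ln (rratio g P Q a) =
  ln 2 * (mutual_info Q (fun t => t.1.1) (fun t => (g t.1.2, t.2)) -
          cond_ent Q (fun t => g t.1.2) (fun t => t.2)).
Proof.
have l2 := lt0r_neq0 ln2_gt0.
(* The entropy of (Z1, X2) cancels between the two terms. *)
rewrite /mutual_info /cond_ent !opprB [X in ln 2 * X](_ : _ =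
  ent Q (fun t => t.1.1) + ent Q (fun t => t.2) -
  ent Q (fun t => (t.1.1, (g t.1.2, t.2)))); last by ring.
rewrite !ent_ln -!mulrDl -mulNr opprK -mulrDl mulrC divfK //.
rewrite -!sumrN -!big_split /=; apply: eq_bigr => -[[x y1] y2] _ /=.
rewrite (pushforwardXZ2 (x, y1, y2)) pushforwardX QP pushforward2 /rratio /=.
have [->|nz] := eqVneq (Q (x, y1, y2)) 0; first by rewrite !mul0r; ring.
have q0 : 0 < Q (x, y1, y2) by rewrite lt_neqAle eq_sym nz Q0.
have m0 : 0 < marg2 Q y2.
  by apply: lt_le_trans (marg12_le_marg2 Q0 y1 _); apply: lt_le_trans q0 (Q_le_marg12 Q0 _ _ _).
have p0 : 0 < P x.
  apply: lt_le_trans q0 _; rewrite -QP -(pushforwardX x).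
  exact: (pushforward_ge (fun t => t.1.1) (x, y1, y2) Q0).
have s0 : 0 < \sum_(y | g y == g y1) Q (x, y, y2).
  by apply: lt_le_trans q0 _; rewrite (bigD1 y1) //= lerDl sumr_ge0.
by rewrite ln_div ?posrE ?mulr_gt0 // lnM ?posrE //; ring.
Qed.

End Information.

(** * Encoder and decoders from a codebook *)

Section CodeFromTrees.
Variables (R : realType) (X Y1 Y2 Z : finType) (g : Y1 -> Z).
Variables (n M0 M1 : nat) (i0 : 'I_M0) (t0 : 'I_M1) (y1 : Y1) (y2 : Y2).
Variable c : {ffun 'I_M0 -> tree Y1 Y2 Z M1 n}.
Variable typ : seq (X * Y1 * Y2) -> bool.

(** Any typical codeword will do; (i0, t0) is sent when there is none. *)
Definition tree_enc (x : {ffun 'I_n -> X}) : 'I_M0 * 'I_M1 :=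
  odflt (i0, t0) [pick p | typ (zip3 (ffun_seq x) (tpath g (c p.1) p.2))].

Definition tree_f0 x := (tree_enc x).1.
Definition tree_f1 x := (tree_enc x).2.
Definition tree_g1 (i : 'I_M0) (t : 'I_M1) (j : 'I_n) : Y1 := (nth (y1, y2) (tpath g (c i) t) j).1.
Definition tree_g2 (j : 'I_n) (i : 'I_M0) (zs : seq Z) : Y2 := odflt y2 (tnode (c i) zs).

Lemma map_nth_enum_ord (S T : Type) (f : S -> T) (s0 : S) s : size s = n ->
  [seq f (nth s0 s j) | j : 'I_n <- enum 'I_n] = map f s.
Proof.
move=> sz; rewrite -[in RHS](take_size s) sz -(map_nth_iota0 s0) ?sz //.
by rewrite -val_enum_ord -!map_comp.
Qed.

Lemma zip3_enum (x : {ffun 'I_n -> X}) (p : seq (Y1 * Y2)) : size p = n ->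
  zip3 (ffun_seq x) p =
  [seq (x j, (nth (y1, y2) p j).1, (nth (y1, y2) p j).2) | j : 'I_n <- enum 'I_n].
Proof.
move=> sp; rewrite -[in LHS](map_id p) -(map_nth_enum_ord id (y1, y2) sp) /zip3 /ffun_seq.
by elim: (enum 'I_n) => //= j s ->.
Qed.

Lemma tree_dec2 x j : dec2_out g tree_f0 tree_f1 tree_g1 tree_g2 x j =
  (nth (y1, y2) (tpath g (c (tree_f0 x)) (tree_f1 x)) j).2.
Proof.
rewrite /dec2_out /tree_g2 /crib_seq /dec1_out /tree_g1.
rewrite (map_nth_enum_ord (fun p => g p.1)) ?size_tpath //.
by rewrite (tnode_tpath g _ _ (y1, y2) (ltn_ord j)).
Qed.

Variable PX : X -> R.
Hypotheses (P0 : forall x, 0 <= PX x) (P1 : \sum_x PX x = 1) (n_gt0 : (0 < n)%N).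

(** A typical codeword has mean distortion at most [B]. When the encoder fails, each letter costs at
    most the sum of all values of [d], and [m] bounds the probability of failure. *)
Lemma tree_code_distortion (d : X * Y1 * Y2 -> R) (B m : R) :
  0 <= B -> (forall a, 0 <= d a) ->
  (forall s, size s = n -> typ s -> \sum_(a <- s) d a <= n%:R * B) ->
  seqsum PX n (fun xs => (~~ found g xs typ c)%:R) <= m ->
  expect (iid PX (n:=n)) (fun x => n%:R^-1 * \sum_(j < n)
    d (x j, dec1_out tree_f0 tree_f1 tree_g1 x j,
            dec2_out g tree_f0 tree_f1 tree_g1 tree_g2 x j)) <=
  B + (\sum_a d a) * m.
Proof.
move=> B0 d0 dB miss.
have n0 : 0 < n%:R :> R by rewrite ltr0n.
have D0 : 0 <= \sum_a d a by apply: sumr_ge0.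
apply: (@le_trans _ _ (\sum_(x : {ffun 'I_n -> X}) (\prod_i PX (x i)) *
   (B + (\sum_a d a) * (~~ found g (ffun_seq x) typ c)%:R))); last first.
  rewrite (sum_ffunE PX n (fun xs => B + (\sum_a d a) * (~~ found g xs typ c)%:R)).
  rewrite seqsumD seqsumZ (_ : seqsum PX n (fun=> B) = B) ?lerD2l ?ler_wpM2l //.
  rewrite -[RHS]mulr1 -(seqsum1 n P1) -seqsumZ; apply: eq_seqsum => s _; rewrite mulr1 //.
apply: ler_sum => x _; rewrite ler_wpM2l ?prodr_ge0 //.
rewrite mulrC ler_pdivrMr //.
set S := \sum_(j < n) _.
set w := tpath g (c (tree_f0 x)) (tree_f1 x).
have SE : S = \sum_(a <- zip3 (ffun_seq x) w) d a.
  rewrite zip3_enum ?size_tpath // big_map big_enum /=; apply: eq_bigr => j _.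
  by rewrite tree_dec2.
have [f|nf] := boolP (found g (ffun_seq x) typ c).
  rewrite mulr0 addr0 SE mulrC; apply: dB.
    by rewrite /zip3 size_map size_zip size_ffun_seq size_tpath minnn.
  rewrite /w /tree_f0 /tree_f1 /tree_enc; case: pickP => [p //|no].
  by move: f => /existsP[i /existsP[t ty]]; have := no (i, t); rewrite /= ty.
rewrite mulr1; apply: (@le_trans _ _ ((\sum_a d a) * n%:R)); last first.
  by rewrite ler_wpM2r ?ler0n // lerDr.
rewrite mulr_natr -[X in _ *+ X]card_ord -sumr_const; apply: ler_sum => j _.
by rewrite (bigD1 (x j, dec1_out tree_f0 tree_f1 tree_g1 x j,
  dec2_out g tree_f0 tree_f1 tree_g1 tree_g2 x j)) //= lerDl sumr_ge0.
Qed.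

End CodeFromTrees.

(** * Achievability by a single random block *)

Section Achievability.
Variables (R : realType) (X Y1 Y2 Z : finType) (PX : X -> R).
Hypothesis HPX : is_pmf PX.
Variables (d1 : X -> Y1 -> R) (d2 : X -> Y2 -> R).
Hypotheses (Hd1 : forall x y, 0 <= d1 x y) (Hd2 : forall x y, 0 <= d2 x y).
Variables (g : Y1 -> Z) (D1 D2 : R).

(** Rounding down a number that is at least one loses at most a factor two. *)
Lemma truncn_expR_ge (x : R) : 0 <= x ->
  (0 < Num.truncn (expR x))%N /\ expR x <= 2 * (Num.truncn (expR x))%:R.
Proof.
move=> x0; have e1 : 1 <= expR x by rewrite -expR0 ler_expR.
have t1 : (0 < Num.truncn (expR x))%N by rewrite truncn_gt0.
split=> //; apply: le_trans (ltW (truncnS_gt _)) _.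
by rewrite -natrM ler_nat mul2n -addnn -addn1 leq_add2l.
Qed.

Lemma pow2_expR (x : R) : 2 `^ x = expR (x * ln 2).
Proof. by rewrite /powR pnatr_eq0. Qed.

Lemma union_bound4 (b1 b2 b3 b4 : bool) :
  1 <= [&& b1, b2, b3 & b4]%:R + ((~~ b1)%:R + (~~ b2)%:R + (~~ b3)%:R + (~~ b4)%:R) :> R.
Proof. by rewrite -!natrD ler1n; case: b1; case: b2; case: b3; case: b4. Qed.

Lemma rate_decay (M A K b e k : R) : 0 <= K -> 0 < M -> expR e <= A * M -> b + k <= e ->
  M^-1 * (K * expR b) <= A * K * expR (- k).
Proof.
move=> K0 M0 eM bk; rewrite mulrC ler_pdivrMr //.
rewrite (_ : _ * M = K * (expR (- k) * (A * M))); last by ring.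
rewrite ler_wpM2l //; apply: le_trans (ler_wpM2l (expR_ge0 _) eM).
by rewrite -expRD ler_expR; lra.
Qed.

(** [sr_region] admits a negative second rate, but a message set is nonempty; hence the positive
    part of [r.2]. *)
Lemma sr_region_achievable (r : R * R) (delta : R) : 0 < delta ->
  sr_region PX d1 d2 g D1 D2 r ->
  achievable PX d1 d2 g D1 D2 (r.1 + delta, Num.max r.2 0 + delta).
Proof.
move=> dl0 [Q [[Q0 Q1] [QX [HD1 [HD2 [HL HR]]]]]] eps eps0.
have [P0 P1] := HPX.
have QP x : \sum_y1 \sum_y2 Q (x, y1, y2) = PX x by rewrite -QX pushforwardX.
have [a0 _] : exists a, Q a != 0.
  apply: contrapT => /forallNP nz; move: Q1; rewrite big1 => [/eqP|a _].
    by rewrite eq_sym oner_eq0.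
  by apply/eqP; have := nz a => /negP; rewrite negbK.
case: a0 => -[x0 y10] y20.
have h0 := ln2_gt0 R; set h := ln 2 in h0.
(* The factor [h] converts bits to nats. Of the four units [eta] in [delta * h], one goes into [c]
   or [b], one into the bound on [prefmax], and one is left for the exponential decay. *)
pose eta := delta * h / 4.
have eta0 : 0 < eta by rewrite divr_gt0 ?mulr_gt0.
have r1 : 0 <= r.1 by apply: le_trans HR; rewrite le_max lexx orbT.
pose c := r.1 * h + eta.
have c0 : 0 <= c by rewrite addr_ge0 ?mulr_ge0 // ltW.
pose b := (r.1 + r.2) * h + eta.
have Lb : \sum_a Q a * ln (lratio PX Q a) < b.
  rewrite (sum_ln_lratio Q0 QP) /b; apply: le_lt_trans (ler_wpM2l (ltW h0) HL) _.
  by rewrite mulrC ltrDl.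
have Rc : \sum_a Q a * ln (rratio g PX Q a) < c.
  rewrite (sum_ln_rratio g Q0 QP) /c mulrC.
  apply: (@le_lt_trans _ _ (r.1 * h)); last by rewrite ltrDl.
  by rewrite ler_wpM2r ?(ltW h0) //; apply: le_trans HR; rewrite le_max lexx.
have [k1 k10 tail1] := tail_sum Q0 Q1 Lb.
have [k2 k20 tail2] := tail_prefmax Q0 Q1 Rc eta0.
have D1lt : \sum_a Q a * d1 a.1.1 a.1.2 < D1 + eps / 2.
  by apply: le_lt_trans HD1 _; rewrite ltrDl divr_gt0.
have D2lt : \sum_a Q a * d2 a.1.1 a.2 < D2 + eps / 2.
  by apply: le_lt_trans HD2 _; rewrite ltrDl divr_gt0.
have [k3 k30 tail3] := tail_sum Q0 Q1 D1lt.
have [k4 k40 tail4] := tail_sum Q0 Q1 D2lt.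
pose dm1 := \sum_(a : X * Y1 * Y2) d1 a.1.1 a.1.2.
pose dm2 := \sum_(a : X * Y1 * Y2) d2 a.1.1 a.2.
have dm10 : 0 <= dm1 by apply: sumr_ge0.
have dm20 : 0 <= dm2 by apply: sumr_ge0.
(* The target failure probability: failures then add at most eps / 2 to either distortion. *)
pose m := eps / 2 / (dm1 + dm2 + 1).
have m0 : 0 < m by rewrite divr_gt0 ?divr_gt0 // ltr_wpDl ?addr_ge0.
have m10 : 0 < m / 10 by rewrite divr_gt0.
have C0 := invP_ge0 Q0 QP; set C := invP PX in C0.
have : \forall n \near \oo, exists k : nat, n = k.+1.
  by near=> n; exists n.-1; rewrite prednK //; near: n; exists 1%N.
(* Rounding costs a factor 2 for M0 and 4 for M0 M1, so both second-moment terms end at m / 10; the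
   four tails, doubled, give the remaining 8 m / 10. *)
have [e1 e2] : 0 < m / 20 /\ 0 < m / 40 by split; rewrite divr_gt0.
have T1 := lin_expRN_small (lexx 0) k10 m10.
have T2 := lin_expRN_small ler01 k20 m10.
have T3 := lin_expRN_small (lexx 0) k30 m10.
have T4 := lin_expRN_small (lexx 0) k40 m10.
have T5 := lin_expRN_small C0 eta0 e1.
have T6 := lin_expRN_small (lexx 0) eta0 e2.
move=> npos.
have [n [[k nk] [S1 [S2 [S3 [S4 [S5 S6]]]]]]] : exists n : nat,
    (exists k, n = k.+1) /\ (0 * n%:R + 1) * expR (- (n%:R * k1)) <= m / 10 /\
    (1 * n%:R + 1) * expR (- (n%:R * k2)) <= m / 10 /\
    (0 * n%:R + 1) * expR (- (n%:R * k3)) <= m / 10 /\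
    (0 * n%:R + 1) * expR (- (n%:R * k4)) <= m / 10 /\
    (C * n%:R + 1) * expR (- (n%:R * eta)) <= m / 20 /\
    (0 * n%:R + 1) * expR (- (n%:R * eta)) <= m / 40.
  near \oo => n; exists n; do !split; near: n; assumption.
rewrite !mul0r !add0r !mul1r in S1 S2 S3 S4 S6.
have n_gt0 : (0 < n)%N by rewrite nk.
have n0 : 0 < n%:R :> R by rewrite ltr0n.
pose e0 := n%:R * (r.1 + delta) * h.
pose e1' := n%:R * (Num.max r.2 0 + delta) * h.
have max0 : 0 <= Num.max r.2 0 by rewrite le_max lexx orbT.
have e00 : 0 <= e0 by rewrite !mulr_ge0 ?addr_ge0 ?(ltW h0) ?(ltW n0) // ltW.
have e10 : 0 <= e1' by rewrite !mulr_ge0 ?addr_ge0 ?(ltW h0) ?(ltW n0) // ltW.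
have [M0pos M0ge] := truncn_expR_ge e00.
have [M1pos M1ge] := truncn_expR_ge e10.
set M0 := Num.truncn (expR e0) in M0pos M0ge.
set M1 := Num.truncn (expR e1') in M1pos M1ge.
(* The four conditions bound, in order, [Lratio], [Rratio] and the two distortions. *)
pose typ (s : seq (X * Y1 * Y2)) : bool :=
  [&& \sum_(a <- s) ln (lratio PX Q a) <= n%:R * b,
      prefmax (fun a => ln (rratio g PX Q a)) c s <= n%:R * eta,
      \sum_(a <- s) d1 a.1.1 a.1.2 <= n%:R * (D1 + eps / 2) &
      \sum_(a <- s) d2 a.1.1 a.2 <= n%:R * (D2 + eps / 2)].
have le_expln (x : R) : 0 <= x -> x <= expR (ln x).
  by rewrite le_eqVlt => /orP[/eqP<-|x0']; rewrite ?expR_ge0 // lnK ?posrE.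
have typL s : (typ s)%:R * Lratio PX Q s <= expR (n%:R * b).
  case: (boolP (typ s)) => [/and4P[t1 _ _ _]|_]; last by rewrite mul0r expR_ge0.
  rewrite mul1r; apply: (@le_trans _ _ (expR (\sum_(a <- s) ln (lratio PX Q a)))).
    rewrite expR_sum; apply: ler_prod => a _.
    by apply/andP; split; [|apply: le_expln]; apply: (lratio_ge0 Q0 QP).
  by rewrite ler_expR.
have typR s : size s = n -> (typ s)%:R * Rratio g PX Q s <=
    (C * n%:R + 1) * expR (n%:R * (c + eta)).
  move=> ss; have K0 : 0 <= C * n%:R + 1 by rewrite addr_ge0 ?mulr_ge0.
  case: (boolP (typ s)) => [/and4P[_ t2 _ _]|_].
    rewrite mul1r; apply: le_trans (foldr_le_prefmax s _ C0 c0) _.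
      by move=> a; apply/andP; split; [|apply: le_expln]; apply: (rratio_ge0 _ Q0 QP).
    by rewrite ss ler_wpM2l // ler_expR [leRHS]mulrDr lerD2l.
  by rewrite mul0r mulr_ge0 ?expR_ge0.
have typ1 : 1 - seqsum Q n (fun s => (typ s)%:R) <= 4 * (m / 10).
  rewrite lerBlDl; apply: (@le_trans _ _ (seqsum Q n (fun=> 1))); first by rewrite seqsum1.
  apply: (@le_trans _ _ (seqsum Q n (fun s => (typ s)%:R +
     ((~~ (\sum_(a <- s) ln (lratio PX Q a) <= n%:R * b))%:R +
      (~~ (prefmax (fun a => ln (rratio g PX Q a)) c s <= n%:R * eta))%:R +
      (~~ (\sum_(a <- s) d1 a.1.1 a.1.2 <= n%:R * (D1 + eps / 2)))%:R +
      (~~ (\sum_(a <- s) d2 a.1.1 a.2 <= n%:R * (D2 + eps / 2)))%:R)))).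
    apply: le_seqsum => // s _; rewrite /typ.
    exact: union_bound4.
  rewrite !seqsumD lerD2l.
  have := tail1 n; have := tail2 n; have := tail3 n; have := tail4 n; lra.
have [code miss] := exists_code g Q0 Q1 QP n typ M0pos M1pos.
have {}miss : seqsum PX n (fun xs => (~~ found g xs typ code)%:R) <= m.
  apply: le_trans miss _.
  have -> : m = 2 * (4 * (m / 10)) + m / 10 + m / 10 by field.
  rewrite !lerD // ?ler_wpM2l //.
    apply: (@le_trans _ _ (M0%:R^-1 * ((C * n%:R + 1) * expR (n%:R * (c + eta))))).
      rewrite ler_wpM2l ?invr_ge0 ?ler0n //.
      apply: (@le_trans _ _ (seqsum Q n (fun=> (C * n%:R + 1) * expR (n%:R * (c + eta)) * 1))).
        by apply: le_seqsum => // s ss; rewrite mulr1 typR.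
      by rewrite seqsumZ seqsum1 // mulr1.
    apply: le_trans (rate_decay (k := n%:R * eta) _ _ M0ge _) _.
    - by rewrite addr_ge0 ?mulr_ge0.
    - by rewrite ltr0n.
    - rewrite /e0 /c -mulrDr -mulrA ler_wpM2l ?(ltW n0) //.
      have : delta * h = 4 * eta by rewrite /eta; field.
      lra.
    - by move: S5; rewrite -mulrA; lra.
  apply: (@le_trans _ _ ((M0%:R * M1%:R)^-1 * (1 * expR (n%:R * b)))).
    rewrite ler_wpM2l ?invr_ge0 ?mulr_ge0 ?ler0n // mul1r.
    apply: (@le_trans _ _ (seqsum Q n (fun=> expR (n%:R * b) * 1))).
      by apply: le_seqsum => // s ss; rewrite mulr1 typL.
    by rewrite seqsumZ seqsum1 // mulr1.
  apply: le_trans (rate_decay (A := 4) (e := e0 + e1') (k := n%:R * eta) _ _ _ _) _ => //.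
  - by rewrite mulr_gt0 ?ltr0n.
  - rewrite expRD (_ : 4 * _ = (2 * M0%:R) * (2 * M1%:R)); last by ring.
    by rewrite ler_pM ?expR_ge0.
  - rewrite /e0 /e1' /b -mulrDr -!mulrA -mulrDr ler_wpM2l ?(ltW n0) //.
    have : delta * h = 4 * eta by rewrite /eta; field.
    have : r.2 * h <= Num.max r.2 0 * h by rewrite ler_wpM2r ?(ltW h0) // le_max lexx.
    lra.
  - by lra.
exists n, M0, M1; split=> //=.
- by rewrite pow2_expR truncn_le expR_ge0.
- by rewrite pow2_expR truncn_le expR_ge0.
pose i0 := Ordinal M0pos; pose t0 := Ordinal M1pos.
exists (tree_f0 g i0 t0 code typ), (tree_f1 g i0 t0 code typ), (tree_g1 g y10 y20 code),
  (tree_g2 y20 code).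
have D1p : 0 <= D1 by apply: le_trans HD1; apply: sumr_ge0 => a _; rewrite mulr_ge0.
have D2p : 0 <= D2 by apply: le_trans HD2; apply: sumr_ge0 => a _; rewrite mulr_ge0.
have mE : (dm1 + dm2 + 1) * m = eps / 2.
  by rewrite /m mulrC divfK // gt_eqF // ltr_wpDl ?addr_ge0.
have tM (dm : R) : 0 <= dm -> dm <= dm1 + dm2 + 1 -> dm * m <= eps / 2.
  by move=> d0 dle; rewrite -mE ler_wpM2r ?(ltW m0).
have B10 : 0 <= D1 + eps / 2 by rewrite addr_ge0 // divr_ge0 // ltW.
have B20 : 0 <= D2 + eps / 2 by rewrite addr_ge0 // divr_ge0 // ltW.
have ty1 s : size s = n -> typ s -> \sum_(a <- s) d1 a.1.1 a.1.2 <= n%:R * (D1 + eps / 2).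
  by move=> _ /and4P[].
have ty2 s : size s = n -> typ s -> \sum_(a <- s) d2 a.1.1 a.2 <= n%:R * (D2 + eps / 2).
  by move=> _ /and4P[].
split.
  apply: le_trans (tree_code_distortion i0 t0 y10 y20 P0 P1 n_gt0
    (d := fun a => d1 a.1.1 a.1.2) B10 (fun a => Hd1 _ _) ty1 miss) _.
  rewrite -addrA lerD2l [leRHS]splitr lerD2l; apply: tM => //.
  by rewrite -addrA lerDl addr_ge0.
apply: le_trans (tree_code_distortion i0 t0 y10 y20 P0 P1 n_gt0
  (d := fun a => d2 a.1.1 a.2) B20 (fun a => Hd2 _ _) ty2 miss) _.
rewrite -addrA lerD2l [leRHS]splitr lerD2l; apply: tM => //.
by rewrite addrAC lerDr addr_ge0.
Unshelve. all: by end_near. Qed.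

End Achievability.

(** * Products of causal kernels *)

Section CausalKernels.
Variables (R : realType) (A : finType).
Implicit Type w : nat -> seq A -> A -> R.

(** A kernel takes the time, the past and the next letter; for the tail the time is shifted and the
    first letter is put in front of the past. *)
Fixpoint causal_prod w (s : seq A) : R :=
  if s is a :: s' then w 0%N [::] a * causal_prod (fun i t => w i.+1 (a :: t)) s' else 1.

Lemma causal_prodE w a0 s :
  causal_prod w s = \prod_(i < size s) w i (take i s) (nth a0 s i).
Proof.
elim: s w => [|a s IH] w /=; first by rewrite big_ord0.
by rewrite big_ord_recl /= IH.
Qed.

Lemma causal_prod_ge0 w s : (forall i t a, 0 <= w i t a) -> 0 <= causal_prod w s.
Proof. by elim: s w => //= a s IH w w0; rewrite mulr_ge0 // IH. Qed.

(** For each first letter the tail sums to at most one by induction. Unit weights make [seqsum] a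
    plain sum over words. *)
Lemma sum_causal_prod_le1 w n : (forall i t a, 0 <= w i t a) ->
  (forall i t, \sum_a w i t a <= 1) -> seqsum (fun=> 1) n (causal_prod w) <= 1.
Proof.
elim: n w => [//|n IH] w w0 w1 /=; apply: le_trans (w1 0%N [::]).
apply: ler_sum => a _; rewrite mul1r seqsumZ -[leRHS]mulr1 ler_wpM2l //.
exact: IH.
Qed.

End CausalKernels.

(** * Single-letter converse bound *)

Section Converse.
Variable R : realType.

Lemma sum_inj_le (T U : finType) (h : T -> U) (F : U -> R) :
  injective h -> (forall u, 0 <= F u) -> \sum_t F (h t) <= \sum_u F u.
Proof.
move=> hi F0; rewrite (partition_big h xpredT) //=; apply: ler_sum => u _.
have [t /eqP <-|no] := pickP (fun t => h t == u); last by rewrite big_pred0.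
by rewrite (big_pred1 t) // => t'; rewrite /= (inj_eq hi).
Qed.

(** Termwise ln u <= u - 1 at u = q / (p M) where p > 0; the mass [M] allowed to [q] accounts for ln
    M. *)
Lemma gibbs (T : finType) (p q : T -> R) (M : R) : 0 < M ->
  (forall t, 0 <= p t) -> \sum_t p t = 1 -> (forall t, 0 <= q t) -> \sum_t q t <= M ->
  (forall t, 0 < p t -> 0 < q t) ->
  \sum_t p t * ln (q t) - \sum_t p t * ln (p t) <= ln M.
Proof.
move=> M0 p0 p1 q0 qM pq.
have pt t : p t * ln (q t) - p t * ln (p t) - p t * ln M <= q t / M - p t.
  have := p0 t; rewrite le_eqVlt => /orP[/eqP<-|pt0].
    by rewrite !mul0r !subr0 divr_ge0 // ltW.
  have qt := pq t pt0.
  have x0 : 0 < q t / (p t * M) by rewrite divr_gt0 ?mulr_gt0.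
  have := @le_ln1Dx R (q t / (p t * M) - 1); rewrite addrCA subrr addr0 ltrBrDl subrr => /(_ x0).
  rewrite ln_div ?posrE ?mulr_gt0 // lnM ?posrE // => le.
  rewrite (_ : q t / M - p t = p t * (q t / (p t * M) - 1)).
    by rewrite -!mulrBr ler_wpM2l //; lra.
  by field; rewrite !gt_eqF.
have := ler_sum (index_enum T) (fun t (_ : xpredT t) => pt t).
rewrite !big_split /= !sumrN -!big_distrl /= p1 mul1r => le.
rewrite -subr_le0; apply: le_trans le _; rewrite subr_le0 ler_pdivrMr ?mul1r //.
Qed.

Lemma pushforward_inj (T U V : finType) (p : T -> R) (f : T -> U) (k : U -> V) u :
  injective k -> Defs.pushforward p (k \o f) (k u) = Defs.pushforward p f u.
Proof. by move=> ki; apply: eq_bigl => t /=; rewrite (inj_eq ki). Qed.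

Lemma ent_inj (T U V : finType) (p : T -> R) (f : T -> U) (k : U -> V) :
  injective k -> ent p (k \o f) = ent p f.
Proof.
move=> ki; rewrite !ent_ln; congr (- _ / _); apply: eq_bigr => t _.
by rewrite /= (pushforward_inj p f _ ki).
Qed.

Variables (X T : finType) (PX : X -> R) (n : nat).
Hypothesis n_gt0 : (0 < n)%N.
Hypotheses (P0 : forall x, 0 <= PX x) (P1 : \sum_x PX x = 1).
Variable tup : {ffun 'I_n -> X} -> 'I_n -> T.

Local Notation p := (iid PX (n:=n)).

Lemma iid_ge0 x : 0 <= p x.
Proof. exact: prodr_ge0. Qed.

Lemma sum_iid : \sum_x p x = 1.
Proof.
rewrite -[RHS](seqsum1 n P1) -sum_ffunE.
by apply: eq_bigr => x _; rewrite mulr1.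
Qed.

Definition time_avg (a : T) : R := n%:R^-1 * \sum_x p x * \sum_i (tup x i == a)%:R.

Lemma sum_time_avg (F : T -> R) :
  \sum_a time_avg a * F a = n%:R^-1 * \sum_x p x * \sum_i F (tup x i).
Proof.
under eq_bigr do rewrite /time_avg -mulrA.
rewrite -big_distrr /=; congr (_ * _).
under eq_bigr do rewrite big_distrl /=.
rewrite exchange_big /=; apply: eq_bigr => x _.
under eq_bigr do rewrite -mulrA.
rewrite -big_distrr /=; congr (_ * _).
under eq_bigr do rewrite big_distrl /=.
rewrite exchange_big /=; apply: eq_bigr => i _.
rewrite (bigD1 (tup x i)) //= eqxx mul1r big1 ?addr0 // => a /negbTE na.
by rewrite eq_sym na mul0r.
Qed.

Lemma time_avg_ge0 a : 0 <= time_avg a.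
Proof.
rewrite mulr_ge0 ?invr_ge0 ?ler0n // sumr_ge0 // => x _.
by rewrite mulr_ge0 ?iid_ge0 // sumr_ge0.
Qed.

Lemma sum_time_avg1 : \sum_a time_avg a = 1.
Proof.
have := sum_time_avg (fun=> 1); under eq_bigr do rewrite mulr1.
move=> ->; under eq_bigr do rewrite sumr_const card_ord.
rewrite -big_distrl /= sum_iid mul1r mulVf //.
by rewrite pnatr_eq0 -lt0n.
Qed.

Lemma time_avg_marg (fX : T -> X) x0 : (forall x i, fX (tup x i) = x i) ->
  Defs.pushforward time_avg fX x0 = PX x0.
Proof.
move=> fXE.
have -> : Defs.pushforward time_avg fX x0 = \sum_a time_avg a * (fX a == x0)%:R.
  rewrite /Defs.pushforward big_mkcond; apply: eq_bigr => a _.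
  by case: eqP; rewrite ?mulr1 ?mulr0.
rewrite sum_time_avg; under eq_bigr do rewrite big_distrr /=.
rewrite exchange_big /= (eq_bigr (fun=> PX x0)).
  by rewrite sumr_const card_ord -[PX x0 *+ n]mulr_natl mulrA mulVf ?mul1r // pnatr_eq0 -lt0n.
move=> i _; under eq_bigr do rewrite fXE.
rewrite (sum_ffun_prod1 i (fun x => (x == x0)%:R) (fun _ => P1)).
rewrite (bigD1 x0) //= eqxx mulr1 big1 ?addr0 // => x /negbTE->.
by rewrite mulr0.
Qed.

(* [gm] is the context available before the letter [al] is revealed: it depends
   only on the message [s] and on the previous letters. *)
Lemma single_letter_bound (A C S : finType) (fX : T -> X) (al : T -> A) (gm : T -> C)
    (s : {ffun 'I_n -> X} -> S) (c : S -> 'I_n -> seq A -> C) :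
  (forall x i, fX (tup x i) = x i) ->
  (forall x i, gm (tup x i) = c (s x) i (take i [seq al (tup x j) | j <- enum 'I_n])) ->
  injective (fun x => (s x, [ffun i => al (tup x i)])) ->
  n%:R * ln 2 * (ent time_avg fX + ent time_avg gm -
                 ent time_avg (fun t => (al t, gm t))) <= ln #|S|%:R.
Proof.
move=> fXE gmE hi; set Q := time_avg.
pose Qag := Defs.pushforward Q (fun t => (al t, gm t)).
pose Qg := Defs.pushforward Q gm.
(* The conditional law of the letter given the context; contexts of probability zero get the zero
   kernel. *)
pose W a k := Qag (a, k) / Qg k.
have Q0 := time_avg_ge0.
have W0 a k : 0 <= W a k by rewrite divr_ge0 ?pushforward_ge0.
have W1 k : \sum_a W a k <= 1.
  rewrite -big_distrl /= (_ : \sum_a Qag (a, k) = Qg k).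
    by have [->|nz] := eqVneq (Qg k) 0; rewrite ?mul0r ?divff.
  rewrite /Qg /Defs.pushforward (partition_big al xpredT) //=.
  by apply: eq_bigr => a _; apply: eq_bigl => t; rewrite xpair_eqE andbC.
(* Kernels are indexed by [nat]; times outside the block get the value 0. *)
pose w m (i : nat) t a := if insub i is Some i' then W a (c m i' t) else 0.
have w0 m i t a : 0 <= w m i t a by rewrite /w; case: insub.
have w1 m i t : \sum_a w m i t a <= 1.
  by rewrite /w; case: insub => [i'|]; rewrite ?W1 // big1.
pose q x := \prod_i W (al (tup x i)) (gm (tup x i)).
have qE x : q x = causal_prod (w (s x)) (ffun_seq [ffun i => al (tup x i)]).
  pose i0 := Ordinal n_gt0.
  rewrite (causal_prodE _ (al (tup x i0))) size_ffun_seq; apply: eq_bigr => i _.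
  rewrite nth_ffun_seq ffunE /w valK gmE; congr (W _ (c _ _ (take _ _))).
  by apply: eq_map => j; rewrite ffunE.
have q0 x : 0 <= q x by apply: prodr_ge0.
have S0 : (0 < #|S|)%N.
  have [x _] : exists x : {ffun 'I_n -> X}, p x != 0.
    apply: contrapT => /forallNP nz; have := sum_iid; rewrite big1 => [/eqP|x _].
      by rewrite eq_sym oner_eq0.
    by apply/eqP; have := nz x => /negP; rewrite negbK.
  by apply/card_gt0P; exists (s x).
have qS : \sum_x q x <= #|S|%:R.
  (* Injectivity embeds the source words into the pairs of a message and a word of letters; each
     message contributes at most one. *)
  pose F (m : S * {ffun 'I_n -> A}) := causal_prod (w m.1) (ffun_seq m.2).
  have -> : \sum_x q x = \sum_x F (s x, [ffun i => al (tup x i)]).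
    by apply: eq_bigr => x _; rewrite qE.
  apply: le_trans (sum_inj_le hi _) _.
    by move=> m; apply: causal_prod_ge0.
  rewrite -(pair_bigA _ (fun m a => F (m, a))) /= -sumr_const; apply: ler_sum => m _.
  apply: le_trans (sum_causal_prod_le1 n (w0 m) (w1 m)).
  rewrite -sum_ffunE le_eqVlt; apply/orP; left; apply/eqP.
  by apply: eq_bigr => a _; rewrite big1 ?mul1r.
have n0 : 0 < n%:R :> R by rewrite ltr0n.
have Qpos x i : 0 < p x -> 0 < Q (tup x i).
  move=> px; rewrite /Q /time_avg mulr_gt0 ?invr_gt0 //.
  rewrite (bigD1 x) //= (bigD1 i) //= eqxx ltr_wpDr //.
    by apply: sumr_ge0 => x' _; rewrite mulr_ge0 ?iid_ge0 // sumr_ge0.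
  by rewrite mulr_gt0 // ltr_wpDr // sumr_ge0.
have Wpos x i : 0 < p x -> 0 < Qag (al (tup x i), gm (tup x i)) /\ 0 < Qg (gm (tup x i)).
  move=> px; split; apply: lt_le_trans (Qpos x i px) _.
    exact: (pushforward_ge (fun t => (al t, gm t)) _ Q0).
  exact: pushforward_ge.
have qpos x : 0 < p x -> 0 < q x.
  by move=> px; apply: prodr_gt0 => i _; have [? ?] := Wpos x i px; rewrite divr_gt0.
have := gibbs (_ : 0 < #|S|%:R) iid_ge0 sum_iid q0 qS qpos.
rewrite ltr0n => /(_ S0); apply: le_trans.
(* Both logarithms below are sums over time, so their means become n times means under the time
   average. *)
have avg F : \sum_x p x * \sum_i F (tup x i) = n%:R * \sum_a Q a * F a.
  by rewrite sum_time_avg mulrA divff ?mul1r ?gt_eqF.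
have -> : \sum_x p x * ln (q x) =
    n%:R * (\sum_a Q a * (ln (Qag (al a, gm a)) - ln (Qg (gm a)))).
  rewrite -avg; apply: eq_bigr => x _.
  have := iid_ge0 x; rewrite le_eqVlt => /orP[/eqP<-|px]; first by rewrite !mul0r.
  congr (_ * _); rewrite /q.
  have : forall i, 0 < Qag (al (tup x i), gm (tup x i)) /\ 0 < Qg (gm (tup x i)).
    by move=> i; apply: Wpos.
  elim: (index_enum _) => [|i r IH] pos; first by rewrite !big_nil ln1.
  have [pa pg] := pos i.
  rewrite !big_cons lnM ?posrE ?divr_gt0 //; last first.
    by apply: prodr_gt0 => j _; have [? ?] := pos j; rewrite divr_gt0.
  by rewrite IH // ln_div ?posrE.
have -> : \sum_x p x * ln (p x) =
    n%:R * (\sum_a Q a * ln (Defs.pushforward Q fX (fX a))).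
  rewrite -avg; apply: eq_bigr => x _.
  have := iid_ge0 x; rewrite le_eqVlt => /orP[/eqP<-|px]; first by rewrite !mul0r.
  congr (_ * _).
  have Ppos i : 0 < PX (x i).
    rewrite lt_neqAle P0 andbT eq_sym; apply/negP => /eqP e.
    by move: px; rewrite /iid (bigD1 i) //= e mul0r ltxx.
  rewrite /iid; under [RHS]eq_bigr do rewrite fXE (time_avg_marg _ fXE).
  elim: (index_enum _) => [|i r IH]; first by rewrite !big_nil ln1.
  by rewrite !big_cons lnM ?posrE ?prodr_gt0 ?IH.
rewrite !ent_ln -mulrBr -mulrA ler_wpM2l ?(ltW n0) //.
rewrite -!mulrDl -mulNr opprK -mulrDl mulrC divfK ?gt_eqF ?ln2_gt0 //.
rewrite (eq_bigr _ (fun t _ => mulrBr _ _ _)) big_split /= sumrN.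
by rewrite le_eqVlt; apply/orP; left; apply/eqP; rewrite -/Q -/Qag -/Qg; ring.
Qed.

End Converse.

(** * Continuity of x ln x *)

Section EntropyContinuity.
Variable R : realType.

(** For y > 0 and s = sqrt y, y ln y = - 2 s^2 ln(1/s), and ln u <= u at u = 1/s. *)
Lemma norm_xlnx_le (y : R) : y <= 1 -> `|y * ln y| <= 2 * Num.sqrt y.
Proof.
move=> y1; have [y0|y0] := leP y 0.
  by rewrite ln0 // mulr0 normr0 mulr_ge0 ?sqrtr_ge0.
have s0 : 0 < Num.sqrt y by rewrite sqrtr_gt0.
have yE : y = Num.sqrt y * Num.sqrt y by rewrite -expr2 sqr_sqrtr // ltW.
have lnE : ln y = - (2 * ln (Num.sqrt y)^-1).
  by rewrite {1}yE lnM ?posrE // lnV ?posrE //; ring.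
have ls : ln (Num.sqrt y)^-1 <= (Num.sqrt y)^-1 by rewrite ltW // ln_sublinear // invr_gt0.
have ly : ln y <= 0 by apply: ln_le0.
rewrite normrM (gtr0_norm y0) (ler0_norm ly) lnE opprK.
apply: le_trans (ler_wpM2l (ltW y0) (ler_wpM2l _ ls)) _ => //.
by rewrite {1}yE le_eqVlt; apply/orP; left; apply/eqP; field; rewrite gt_eqF.
Qed.

Lemma continuous_xlnx : continuous (fun x : R => x * ln x).
Proof.
move=> x; have [x0|x0|->] := ltgtP x 0.
- apply: (cvg_trans _ (_ : cst (0 : R) y @[y --> x] --> x * ln x)).
    apply: near_eq_cvg; near=> y; rewrite ln0 ?mulr0 //; near: y.
    exact: lt_le_nbhsl.
  by rewrite ln0 ?(ltW x0) // mulr0; apply: cvg_cst.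
- by apply: cvgM; [exact: cvg_id|exact: continuous_ln].
have : y * ln y @[y --> (0 : R)] --> (0 : R); last by rewrite -[X in _ --> X](mul0r (ln (0 : R))).
apply/cvgrPdist_le => e e0; near=> y.
rewrite sub0r normrN; apply: le_trans (norm_xlnx_le _) _.
  by near: y; apply: lt_le_nbhsl.
have y4 : y <= (e / 2) ^+ 2.
  by near: y; apply: lt_le_nbhsl; rewrite exprn_gt0 // divr_gt0.
rewrite mulrC -ler_pdivlMr // -[leRHS]ger0_norm ?divr_ge0 ?(ltW e0) //.
by rewrite -sqrtr_sqr ler_wsqrtr.
Unshelve. all: by end_near. Qed.

End EntropyContinuity.

(** * Limits of laws on a finite set *)

Section SimplexLimits.
Variables (R : realType) (T : finType).

Local Notation E := (prod_topology (fun _ : T => R)).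

Lemma continuous_finsum (S : topologicalType) (I : finType) (P : pred I) (F : I -> S -> R) :
  (forall i, continuous (F i)) -> continuous (fun x => \sum_(i | P i) F i x).
Proof. by move=> Fc; apply: (continuous_big add_continuous) => i _; apply: Fc. Qed.

Lemma continuous_mulc (S : topologicalType) (f : S -> R) (c : R) :
  continuous f -> continuous (fun x => f x * c).
Proof. by move=> fc x; apply: cvgM; [apply: fc|apply: cvg_cst]. Qed.

Lemma continuous_addf (S : topologicalType) (f h : S -> R) :
  continuous f -> continuous h -> continuous (fun x => f x + h x).
Proof. by move=> fc hc x; apply: cvgD; [apply: fc|apply: hc]. Qed.

Lemma continuous_oppf (S : topologicalType) (f : S -> R) :
  continuous f -> continuous (fun x => - f x).
Proof. by move=> fc x; apply: cvgN; apply: fc. Qed.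

Lemma continuous_xlnx_comp (S : topologicalType) (f : S -> R) :
  continuous f -> continuous (fun x => f x * ln (f x)).
Proof. by move=> fc x; apply: (continuous_comp (fc x) (@continuous_xlnx R (f x))). Qed.

Lemma continuous_eval t : continuous (fun Q : E => (Q : T -> R) t).
Proof. exact: proj_continuous. Qed.

Lemma continuous_expect (F : T -> R) : continuous (fun Q : E => expect (Q : T -> R) F).
Proof.
apply: (@continuous_finsum E) => t.
apply: (@continuous_mulc E (fun Q : E => (Q : T -> R) t)).
exact: continuous_eval.
Qed.

Lemma continuous_ent (U : finType) (f : T -> U) : continuous (fun Q : E => ent (Q : T -> R) f).
Proof.
have -> : (fun Q : E => ent (Q : T -> R) f) = (fun Q : E =>
    (\sum_u (\sum_(t | f t == u) (Q : T -> R) t) * ln (\sum_(t | f t == u) (Q : T -> R) t))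
    * - (ln 2)^-1).
  apply: funext => Q; rewrite /ent /entropy mulrN big_distrl /=; congr (- _).
  apply: eq_bigr => u _; case: eqP => [|_].
    by rewrite /Defs.pushforward => ->; rewrite !mul0r.
  by rewrite /log2 /Defs.pushforward mulrA.
apply: (@continuous_mulc E); apply: (@continuous_finsum E) => u.
apply: (@continuous_xlnx_comp E).
by apply: (@continuous_finsum E) => t; apply: continuous_eval.
Qed.

Lemma continuous_mutual_info (U V : finType) (f : T -> U) (h : T -> V) :
  continuous (fun Q : E => mutual_info (Q : T -> R) f h).
Proof.
apply: (@continuous_addf E); last by apply: (@continuous_oppf E); apply: continuous_ent.
by apply: (@continuous_addf E); apply: continuous_ent.
Qed.

Lemma continuous_cond_ent (U V : finType) (f : T -> U) (h : T -> V) :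
  continuous (fun Q : E => cond_ent (Q : T -> R) f h).
Proof.
by apply: (@continuous_addf E); [|apply: (@continuous_oppf E)]; apply: continuous_ent.
Qed.

Lemma pmf_le1 (Q : T -> R) t : is_pmf Q -> 0 <= Q t <= 1.
Proof. by case=> Q0 <-; rewrite Q0 (bigD1 t) //= lerDl sumr_ge0. Qed.

(** By Tychonoff the unit cube is compact. A cluster point lies in every closed set that contains a
    tail of the sequence, in particular in closed sublevel sets; no subsequence has to be
    extracted. *)
Lemma simplex_cluster (Qn : nat -> T -> R) : (forall n, is_pmf (Qn n)) ->
  exists Q : T -> R, forall F : E -> R, continuous F -> forall c N,
    (forall n, (N <= n)%N -> F (Qn n) <= c) -> F Q <= c.
Proof.
move=> Qp; pose cube := [set Q : E | forall t, `[(0 : R), 1] ((Q : T -> R) t)].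
have cc : compact cube.
  exact: (@tychonoff T (fun=> R) (fun=> `[(0 : R), 1]) (fun=> @segment_compact R 0 1)).
pose Fl := (Qn : nat -> E) @ \oo.
have Flc : Fl cube.
  by exists 0%N => // n _ t /=; rewrite in_itv /= pmf_le1.
have [Q [_ clQ]] := cc Fl _ Flc.
exists Q => F Fc c N FN.
have cl : closed (F @^-1` [set x | x <= c]).
  apply: preimage_closed; first by move=> x _; apply: Fc.
  exact: closed_le.
have clE := closure_id (F @^-1` [set x | x <= c]); have {}clE := clE.1 cl.
suff : closure (F @^-1` [set x | x <= c]) Q by rewrite -clE.
move: clQ; rewrite clusterE => /(_ (F @^-1` [set x | x <= c])); apply.
by exists N.
Qed.

End SimplexLimits.

(** * The converse inclusion and the equality of closures *)

Section Main.
Variables (R : realType) (X Xh1 Xh2 Zh1 : finType) (PX : X -> R).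
Hypothesis HPX : is_pmf PX.
Variables (d1 : X -> Xh1 -> R) (d2 : X -> Xh2 -> R) (g : Xh1 -> Zh1) (D1 D2 : R).

Local Notation T := (X * Xh1 * Xh2)%type.
Local Notation E := (prod_topology (fun _ : T => R)).

Lemma ln_le_log2_rate (M n : nat) (r : R) : (0 < n)%N -> (0 < M)%N ->
  M%:R <= 2 `^ (n%:R * r) -> ln M%:R <= n%:R * ln 2 * r.
Proof.
move=> n0 M0 le; rewrite mulrAC -ler_expR lnK ?posrE ?ltr0n //.
by rewrite -pow2_expR.
Qed.

(** The law is the time average of a code with slack [eps]: distortions are linear in it, and both
    information bounds come from [single_letter_bound]. *)
Lemma achievable_law (r : R * R) (eps : R) : 0 < eps ->
  achievable PX d1 d2 g D1 D2 r ->
  exists Q : T -> R,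
    [/\ is_pmf Q, forall x, Defs.pushforward Q (fun t => t.1.1) x = PX x,
        expect Q (fun t => d1 t.1.1 t.1.2) <= D1 + eps /\
        expect Q (fun t => d2 t.1.1 t.2) <= D2 + eps,
        mutual_info Q (fun t => t.1.1) (fun t => (t.1.2, t.2)) <= r.1 + r.2 &
        mutual_info Q (fun t => t.1.1) (fun t => (g t.1.2, t.2))
          - cond_ent Q (fun t => g t.1.2) (fun t => t.2) <= r.1 /\ 0 <= r.1].
Proof.
move=> eps0 /(_ eps eps0)[n [M0 [M1 [n0 hM0 hM1 [f0 [f1 [g1 [g2 [hd1 hd2]]]]]]]]].
have [P0 P1] := HPX.
have [x0 _] : exists x : X, PX x != 0.
  apply: contrapT => /forallNP nz; move: P1; rewrite big1 => [/eqP|x _].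
    by rewrite eq_sym oner_eq0.
  by apply/eqP; have := nz x => /negP; rewrite negbK.
have M0p : (0 < M0)%N by apply: leq_ltn_trans (ltn_ord (f0 [ffun=> x0])).
have M1p : (0 < M1)%N by apply: leq_ltn_trans (ltn_ord (f1 [ffun=> x0])).
pose tup (x : {ffun 'I_n -> X}) (i : 'I_n) : T :=
  (x i, dec1_out f0 f1 g1 x i, dec2_out g f0 f1 g1 g2 x i).
have nl : 0 < n%:R * ln 2 :> R by rewrite mulr_gt0 ?ln2_gt0 // ltr0n.
have l0 := ln_le_log2_rate n0 M0p hM0; have l1 := ln_le_log2_rate n0 M1p hM1.
have lM0 : 0 <= ln M0%:R :> R by rewrite ln_ge0 // ler1n.
exists (time_avg PX tup); split.
- by split; [exact: time_avg_ge0|exact: sum_time_avg1].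
- by move=> x; apply: time_avg_marg.
- split; rewrite /expect sum_time_avg.
    apply: le_trans hd1; rewrite /expect big_distrr /= le_eqVlt; apply/orP; left; apply/eqP.
    by apply: eq_bigr => x _; rewrite mulrCA.
  apply: le_trans hd2; rewrite /expect big_distrr /= le_eqVlt; apply/orP; left; apply/eqP.
  by apply: eq_bigr => x _; rewrite mulrCA.
(* Message (T0, T1), letter X, context (X1, X2): both outputs are functions of the messages, so [c]
   ignores the past. *)
- rewrite -(ler_pM2l nl); pose c (m : 'I_M0 * 'I_M1) (i : 'I_n) (_ : seq X) :=
    (g1 m.1 m.2 i, g2 i m.1 (take i [seq g (g1 m.1 m.2 j) | j <- enum 'I_n])).
  have inj : injective (fun x => ((f0 x, f1 x), [ffun i => (tup x i).1.1])).
    by move=> x y [_ _ /ffunP e]; apply/ffunP => i; have := e i; rewrite !ffunE.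
  apply: le_trans (@single_letter_bound _ _ _ _ _ n0 P0 P1 tup _ _ _ (fun t => t.1.1)
    (fun t => t.1.1) (fun t => (t.1.2, t.2)) (fun x => (f0 x, f1 x)) c
    (fun _ _ => erefl) (fun _ _ => erefl) inj) _.
  rewrite card_prod !card_ord natrM lnM ?posrE ?ltr0n //.
  by rewrite mulrDr lerD.
(* M0 >= 1 forces a nonnegative first rate. *)
split; last by rewrite -(ler_pM2l nl) mulr0; apply: le_trans l0.
(* Message T0, letter (X, Z1), context X2: by strict causality the context depends only on T0 and
   the past values of Z1. *)
rewrite -(ler_pM2l nl); pose c (m : 'I_M0) (i : 'I_n) (s : seq (X * Zh1)) :=
  g2 i m [seq a.2 | a <- s].
apply: le_trans l0; rewrite -[in leRHS](card_ord M0).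
have inj : injective (fun x => (f0 x, [ffun i => ((tup x i).1.1, g (tup x i).1.2)])).
  by move=> x y [_ /ffunP e]; apply/ffunP => i; have := e i; rewrite !ffunE => -[].
have crib x i : (tup x i).2 =
    c (f0 x) i (take i [seq ((tup x j).1.1, g (tup x j).1.2) | j <- enum 'I_n]).
  by rewrite /c map_take -map_comp.
apply: le_trans (@single_letter_bound _ _ _ _ _ n0 P0 P1 tup _ _ _ (fun t => t.1.1)
  (fun t => (t.1.1, g t.1.2)) (fun t => t.2) f0 c (fun _ _ => erefl) crib inj).
(* Both sides are H(X) + H(X2) - H(X, Z1, X2), up to the bracketing of the triple. *)
rewrite le_eqVlt; apply/orP; left; apply/eqP; congr (_ * _).
rewrite /mutual_info /cond_ent.
rewrite -(ent_inj (time_avg PX tup) (fun t : T => (t.1.1, (g t.1.2, t.2)))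
  (k := fun p => (p.1, p.2.1, p.2.2))); last by case=> [? [? ?]] [? [? ?]] [-> -> ->].
by rewrite /comp /=; ring.
Qed.

(** The laws for slack 1/(n+1) have a cluster point, where the continuous constraints hold without
    slack; lower bounds and equalities come from applying upper bounds to -F as well. *)
Lemma achievable_sr_region (r : R * R) :
  achievable PX d1 d2 g D1 D2 r -> sr_region PX d1 d2 g D1 D2 r.
Proof.
move=> ach; pose e n : R := n.+1%:R^-1.
have e0 n : 0 < e n by rewrite invr_gt0.
have [Qn Qp] := choice (fun n => achievable_law (e0 n) ach).
have [Q limQ] := simplex_cluster (fun n => let: And5 p _ _ _ _ := Qp n in p).
have ge (F : E -> R) c : continuous F -> (forall n, c <= F (Qn n)) -> c <= F Q.
  move=> Fc cF; rewrite -lerN2; apply: (limQ (fun Q : E => - F Q) _ _ 0%N).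
    exact: (@continuous_oppf R E F).
  by move=> n _; rewrite lerN2.
have eq (F : E -> R) c : continuous F -> (forall n, F (Qn n) = c) -> F Q = c.
  move=> Fc cF; apply/eqP; rewrite eq_le (limQ _ Fc c 0%N) ?ge // => n.
    by rewrite cF.
  by move=> _; rewrite cF.
have le_eps (F : E -> R) c : continuous F -> (forall n, F (Qn n) <= c + e n) -> F Q <= c.
  move=> Fc cF; apply/ler_addgt0Pr => eps eps0.
  (* From this index on, 1/(n+1) is at most [eps]. *)
  apply: (limQ _ Fc _ (Num.truncn eps^-1)) => n Nn; apply: le_trans (cF n) _.
  rewrite lerD2l /e invf_ple ?posrE //; apply: le_trans (ltW (truncnS_gt _)) _.
  by rewrite ler_nat.
exists [ffun t => Q t].
have -> : ([ffun t => Q t] : T -> R) = Q by apply: funext => t; rewrite ffunE.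
split; [split|split; [|split; [|split; [|split]]]].
- move=> t; apply: (ge (fun Q : E => (Q : T -> R) t)) => [|n]; last by case: (Qp n) => -[].
  exact: continuous_eval.
- apply: (eq (fun Q : E => \sum_t (Q : T -> R) t)) => [|n]; last by case: (Qp n) => -[].
  by apply: (@continuous_finsum R E) => t; apply: continuous_eval.
- move=> x; apply: (eq (fun Q : E => Defs.pushforward (Q : T -> R) (fun t => t.1.1) x)) => [|n].
    by apply: (@continuous_finsum R E) => t; apply: continuous_eval.
  by case: (Qp n).
- apply: (le_eps (fun Q : E => expect (Q : T -> R) (fun t => d1 t.1.1 t.1.2))) => [|n].
    exact: continuous_expect.
  by case: (Qp n) => _ _ [].
- apply: (le_eps (fun Q : E => expect (Q : T -> R) (fun t => d2 t.1.1 t.2))) => [|n].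
    exact: continuous_expect.
  by case: (Qp n) => _ _ [].
- apply: (limQ (fun Q : E => mutual_info (Q : T -> R) (fun t => t.1.1) (fun t => (t.1.2, t.2)))
    _ _ 0%N) => [|n _]; last by case: (Qp n).
  exact: continuous_mutual_info.
rewrite ge_max; apply/andP; split; last by case: (Qp 0%N) => _ _ _ _ [].
apply: (limQ (fun Q : E => mutual_info (Q : T -> R) (fun t => t.1.1) (fun t => (g t.1.2, t.2)) -
  cond_ent (Q : T -> R) (fun t => g t.1.2) (fun t => t.2)) _ _ 0%N) => [|n _].
  apply: (@continuous_addf R E); first exact: continuous_mutual_info.
  by apply: (@continuous_oppf R E); apply: continuous_cond_ent.
by case: (Qp n) => _ _ _ _ [].
Qed.

End Main.

Theorem theorem4 (R : realType) (X Xh1 Xh2 Zh1 : finType) (PX : X -> R)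
  (HPX : is_pmf PX)
  (d1 : X -> Xh1 -> R) (d2 : X -> Xh2 -> R)
  (Hd1 : forall x y, 0 <= d1 x y) (Hd2 : forall x y, 0 <= d2 x y)
  (g : Xh1 -> Zh1) (D1 D2 : R) (R0 R1 : R) :
  0 <= R0 -> 0 <= R1 ->
  (closure [set r | achievable PX d1 d2 g D1 D2 r] (R0, R1) <->
   closure [set r | sr_region PX d1 d2 g D1 D2 r] (R0, R1)).
Proof.
move=> R00 R10; split.
  by apply: closure_subset => r; apply: achievable_sr_region.
move=> cl B /nbhs_ballP[e /= e0 eB].
(* A point of the region within e / 2, raised by e / 4 in each rate, is achievable and stays within
   e. *)
have e20 : 0 < e / 2 by rewrite divr_gt0.
have [r [sr br]] := cl _ (nbhsx_ballx (R0, R1) (e / 2) e20).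
exists (r.1 + e / 4, Num.max r.2 0 + e / 4); split.
  by apply: sr_region_achievable => //; rewrite divr_gt0.
case: br => b1 b2; apply: eB; split; move: b1 b2; rewrite -!ball_normE /= !ltr_norml;
  move=> /andP[b1 b1'] /andP[b2 b2']; first by apply/andP; split; lra.
(* Since R1 >= 0, taking the positive part of [r.2] does not move it away from R1. *)
by case: (leP r.2 0) => r20; apply/andP; split; lra.
Qed.
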